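(* Let $f\in C^\infty(\mathbb{R}^n\times\mathbb{R},\mathbb{R}^n)$ with $f(0,0)=0$, and assume that the system $\dot x=f(x,u)$ is smoothly small-time locally controllable. Then $\mathcal{S}_2+\mathbb{R}d_0=\mathcal{S}_1$, where $d_0:=\partial_u^2f(0,0)$ and $\mathcal{S}_1,\mathcal{S}_2$ are the Lie spaces associated with $f_0(x):=f(x,0)$ and $f_1(x):=\partial_uf(x,0)$.
   Context: Trajectory: $(x,u)\in C^0([0,T],\mathbb{R}^n)\times L^\infty((0,T),\mathbb{R})$ is a trajectory of $\dot x=f(x,u)$ with $x(0)=x^*$ if $x(t)=x^*+\int_0^t f(x(s),u(s))\,\mathrm{d}s$ for all $t\in[0,T]$. Lie spaces: $[X,Y](x):=Y'(x)X(x)-X'(x)Y(x)$. For $k\ge1$, $\mathcal{S}_k\subset\mathbb{R}^n$ is the linear span of the values at $0$ of all iterated Lie brackets of $f_0$ and $f_1$ (any nesting structure) containing $f_1$ at most $k$ times. Controllability: for $m\in\mathbb{N}$, the system is $C^m$ small-time locally controllable if for any $T>0$ and $\eta>0$ there exists $\delta>0$ such that, for all $x^*,x^\dagger\in\mathbb{R}^n$ with $|x^*|+|x^\dagger|\le\delta$, there is a trajectory $(x,u)$ on $[0,T]$ with $u\in C^m([0,T])$, $\|u\|_{C^m}\le\eta$, $x(0)=x^*$ and $x(T)=x^\dagger$. It is smoothly small-time locally controllable if it is $C^m$ small-time locally controllable for every $m\in\mathbb{N}$. *)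

(* Defs.v *)
From HB Require Import structures.
From mathcomp Require Import all_boot all_order all_algebra.
From mathcomp Require Import all_classical all_reals all_analysis.

Set Implicit Arguments.
Unset Strict Implicit.
Unset Printing Implicit Defensive.

Import Order.TTheory GRing.Theory Num.Theory.
Import numFieldNormedType.Exports.

Local Open Scope ring_scope.
Local Open Scope classical_set_scope.


(** * Smooth maps

[f] is [C^(k+1)] iff it is differentiable and all its directional derivatives
are [C^k]; this is the usual notion when [V] is finite dimensional, the only
case used below. *)

Fixpoint Ck {R : realType} {V W : normedModType R} (k : nat) (f : V -> W) :
    Prop :=
  if k is k'.+1 then
    (forall x, differentiable f x) /\ (forall v, Ck k' ('D_v f))
  else continuous f.

Definition smooth {R : realType} {V W : normedModType R} (f : V -> W) : Prop :=
  forall k, Ck k f.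

(** * Controls of class [C^m] on a compact interval

The derivatives are taken on [`]a, b[], where they are genuine two-sided
derivatives, and are required to extend continuously to [`[a, b]]. The suprema
over [`]a, b[] in the norm are those of the continuous extensions over
[`[a, b]]. *)

Definition Cm_itv {R : realType} (m : nat) (a b : R) (u : R -> R) : Prop :=
  [/\ {within `[a, b], continuous u},
      forall j : nat, (j < m)%N ->
        {in `]a, b[, forall t, derivable (u^`(j)) t 1} &
      forall j : nat, (j <= m)%N ->
        exists g : R -> R,
          {within `[a, b], continuous g} /\ {in `]a, b[, u^`(j) =1 g}].

Definition Cm_norm {R : realType} (m : nat) (a b : R) (u : R -> R) : R :=
  \big[Num.max/0]_(j < m.+1) sup [set `|u^`(j) t| | t in `]a, b[].

(** * Trajectories

Only the values of [x] on [`[0, T]] and of [u] on [`]0, T[] (up to a null set)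
matter. The vector-valued integral is taken coordinatewise. *)

Definition trajectory {R : realType} {n : nat} (f : 'rV[R]_n * R -> 'rV[R]_n)
    (T : R) (xs : 'rV[R]_n) (x : R -> 'rV[R]_n) (u : R -> R) : Prop :=
  [/\ {within `[0, T], continuous x},
      (u \_ `]0, T[) \in Lfun (@lebesgue_measure R) +oo%E &
      {in `[0, T], forall t (i : 'I_n),
        x t 0 i = xs 0 i
          + \int[@lebesgue_measure R]_(s in `[0, t]) (f (x s, u s) 0 i)}].

(** * Small-time local controllability

The norm of ['rV[R]_n] is the sup norm; since all norms of [R^n] are equivalent
and [delta] is existentially quantified, the choice of norm is immaterial. *)

Definition Cm_STLC {R : realType} {n : nat} (f : 'rV[R]_n * R -> 'rV[R]_n)
    (m : nat) : Prop :=
  forall T eta : R, 0 < T -> 0 < eta ->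
  exists2 delta : R, 0 < delta &
  forall xs xd : 'rV[R]_n, `|xs| + `|xd| <= delta ->
  exists (x : R -> 'rV[R]_n) (u : R -> R),
    [/\ trajectory f T xs x u, Cm_itv m 0 T u, Cm_norm m 0 T u <= eta,
        x 0 = xs & x T = xd].

Definition smoothly_STLC {R : realType} {n : nat}
    (f : 'rV[R]_n * R -> 'rV[R]_n) : Prop :=
  forall m : nat, Cm_STLC f m.

(** * Lie spaces *)

Definition lie_bracket {R : realType} {V : normedModType R} (X Y : V -> V) :
    V -> V :=
  fun x => 'd Y x (X x) - 'd X x (Y x).

(** [iter_bracket f0 f1 k X]: [X] is the value of a formal iterated bracket of
[f0] and [f1] in which [f1] occurs exactly [k] times. *)

Inductive iter_bracket {R : realType} {V : normedModType R} (f0 f1 : V -> V) :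
    nat -> (V -> V) -> Prop :=
| iter_bracket0 : iter_bracket f0 f1 0 f0
| iter_bracket1 : iter_bracket f0 f1 1 f1
| iter_bracketL p q X Y :
    iter_bracket f0 f1 p X -> iter_bracket f0 f1 q Y ->
    iter_bracket f0 f1 (p + q) (lie_bracket X Y).

Definition lin_span {R : realType} {n : nat} (A : set 'rV[R]_n) :
    set 'rV[R]_n :=
  [set v | exists2 e : seq 'rV[R]_n, (forall w, w \in e -> A w) &
                                     v \in <<e>>%VS].

Definition lie_space {R : realType} {n : nat} (f0 f1 : 'rV[R]_n -> 'rV[R]_n)
    (k : nat) : set 'rV[R]_n :=
  lin_span [set v | exists (j : nat) (X : 'rV[R]_n -> 'rV[R]_n),
                      [/\ (j <= k)%N, iter_bracket f0 f1 j X & v = X 0]].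

(* Main.v *)
Require Import Defs.
From mathcomp Require Import all_boot all_order all_algebra.
From mathcomp Require Import all_classical all_reals all_analysis.
From mathcomp Require Import ring lra.

Set Implicit Arguments.
Unset Strict Implicit.
Unset Printing Implicit Defensive.

Import Order.TTheory GRing.Theory Num.Theory.
Import numFieldNormedType.Exports.

Local Open Scope ring_scope.
Local Open Scope classical_set_scope.

(** Let [A = f0'(0)], [b = f1(0)], [b_i = A^i b]; then [S_1] is spanned by the
[b_i], and, by the Jacobi identity, modulo [S_1] everything in [S_2] is governed
by the drift vectors [d_0 = D_u^2 f(0,0)] and [d_(k+1) = +-[ad^k f1, ad^(k+1) f1](0)].
Assume that [k] is minimal with [d_k] outside [S_1]. If [b_0, ..., b_(k-1)] are
dependent, the Jacobi identity expresses [d_k] by earlier brackets. Otherwise,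
integrating by parts [k] times in the second order expansion of a trajectory
from [0] shows that, transversally to [S_1], the final state is
[1/2 (int v^2) d_k], where [v] is the [k]-th primitive of the control [u], up to
[O(T int v^2 + sup |u|^3)]. An interpolation inequality bounds [sup |u|^3] by an
arbitrarily small multiple of [int v^2] when [u] is small in [C^(2k+2)]. Hence
for small [T] no point [- tau d_k] with [tau > 0] is reachable. *)

(** * Calculus on a time interval *)

(** The obstacle is the boundary terms that the integrations by parts leave at the final time, where
    nothing constrains the primitives of the control. They are recovered from the target, which is
    taken in the range of a projector [Pi] with kernel $S_1$. Applying [Pi] to [rho k] at time [T]
    removes the sum of the ph_(i+1)(T) b_i and keeps x(T), so this sum is O(|rho_k(T)|);
    independence of b_0, ..., b_(k-1) then bounds each primitive separately. The boundary terms are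
    quadratic in these quantities, hence as small as the remainder. In the dependent case this
    recovery fails, and algebra replaces it. The order of the choices matters: the constants of the
    estimate do not depend on [T], so [T] is fixed first from |d_k|, then the size of the control
    from [T], and only then the radius given by controllability. Vectors are rows and matrices act
    on the right, so A^i b reads b A^i. *)

Section calculus.
Context {R : realType}.
Implicit Types (T : R) (F G f g : R -> R).

(** The derivative is two-sided even at 0 and [T]. Functions known only on the interval are replaced
    by primitives of clamped functions, for which this makes sense. *)
Definition has_deriv T F f :=
  forall t : R, 0 <= t <= T -> is_derive t (1 : R) F (f t).

Lemma has_deriv_within T F f : has_deriv T F f -> {within `[0, T], continuous F}.
Proof.
move=> dF; apply: derivable_within_continuous => t; rewrite in_itv /= => /dF Ft.
exact: ex_derive.
Qed.

Lemma has_deriv_homo T F f : has_deriv T F f ->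
  (forall t, 0 <= t <= T -> 0 <= f t) ->
  forall s t, 0 <= s -> s <= t -> t <= T -> F s <= F t.
Proof.
move=> dF f0 s t s0 st tT.
have dFst x : x \in `[s, t]%R -> is_derive x (1 : R) F (f x).
  by rewrite in_itv /= => /andP[sx xt]; apply: dF;
    rewrite (le_trans s0)//= (le_trans xt).
have dFst' x : x \in `]s, t[%R -> is_derive x (1 : R) F (f x).
  by move=> /subset_itv_oo_cc; exact: dFst.
have cF : {within `[s, t], continuous F}.
  by apply: derivable_within_continuous => x /dFst ?; exact: ex_derive.
have [c] := MVT_segment st dFst' cF.
rewrite in_itv /= => /andP[sc ct] E.
by rewrite -subr_ge0 E mulr_ge0 ?subr_ge0// f0// (le_trans s0)//= (le_trans ct).
Qed.

Lemma has_deriv_ge0 T F f : has_deriv T F f ->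
  (forall t, 0 <= t <= T -> 0 <= f t) ->
  forall t, 0 <= t <= T -> F 0 <= F t.
Proof. by move=> dF f0 t /andP[t0 tT]; exact: (has_deriv_homo dF f0). Qed.

Lemma has_deriv_le T F f G g : has_deriv T F f -> has_deriv T G g ->
  (forall t, 0 <= t <= T -> f t <= g t) ->
  forall t, 0 <= t <= T -> F t - F 0 <= G t - G 0.
Proof.
move=> dF dG fg t tT.
have dGF : has_deriv T (G - F) (g - f).
  by move=> s sT; have := dF s sT; have := dG s sT => *; exact: is_deriveB.
have /(has_deriv_ge0 dGF)/(_ _ tT) : forall s, 0 <= s <= T -> 0 <= (g - f) s.
  by move=> s sT; rewrite subr_ge0; exact: fg.
by rewrite /= !fctE; lra.
Qed.

Lemma has_deriv_norm T F f G g : has_deriv T F f -> has_deriv T G g ->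
  (forall t, 0 <= t <= T -> `|f t| <= g t) ->
  forall t, 0 <= t <= T -> `|F t - F 0| <= G t - G 0.
Proof.
move=> dF dG fg t tT; rewrite ler_norml; apply/andP; split; last first.
  by apply: (has_deriv_le dF dG) tT => s sT; rewrite (le_trans (ler_norm _)) ?fg.
have dN : has_deriv T (- G) (- g).
  by move=> s sT; have := dG s sT => *; exact: is_deriveN.
have /(has_deriv_le dN dF)/(_ _ tT) : forall s, 0 <= s <= T -> (- g) s <= f s.
  by move=> s /fg; rewrite ler_norml => /andP[].
by rewrite !fctE; lra.
Qed.

Lemma clamp_continuous T g : 0 <= T -> {within `[0, T], continuous g} ->
  continuous (fun t => g (Num.max 0 (Num.min T t))).
Proof.
move=> T0 /subspace_continuousP cg t.
set c : R -> R := fun t => Num.max 0 (Num.min T t).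
have cI s : `[0, T]%classic (c s).
  by rewrite /= in_itv /= /c le_max lexx /= ge_max T0 ge_min lexx.
have /cvgrPdist_lt h := cg _ (cI t); apply/cvgrPdist_lt => e e0.
have := h e e0; rewrite /prop_near1 /within /= => -[d /= d0 dP].
exists d => //= s ts; apply: dP; last exact: cI.
apply: le_lt_trans ts => /=.
have lip_max (a b : R) : `|Num.max 0 a - Num.max 0 b| <= `|a - b|.
  have := ler_norm (a - b); have := ler_norm (- (a - b)); rewrite normrN.
  by case: (leP 0 a) => ?; case: (leP 0 b) => ? ? ?;
     rewrite ler_norml; apply/andP; split; lra.
apply: le_trans (lip_max _ _) _.
have := ler_norm (t - s); have := ler_norm (- (t - s)); rewrite normrN.
by case: (leP T t) => ?; case: (leP T s) => ? ? ?;
   rewrite ler_norml; apply/andP; split; lra.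
Qed.

Lemma clampE T (t : R) : 0 <= t <= T -> Num.max 0 (Num.min T t) = t.
Proof. by case/andP => t0 tT; rewrite (min_idPr tT); exact/max_idPr. Qed.

Lemma within_primitive T g : 0 <= T -> {within `[0, T], continuous g} ->
  exists G, [/\ G 0 = 0, has_deriv T G g &
    forall t, 0 <= t <= T -> \int[@lebesgue_measure R]_(s in `[0, t]) g s = G t].
Proof.
move=> T0 cg; set gc := fun t => g (Num.max 0 (Num.min T t)).
have cgc : continuous gc := clamp_continuous T0 cg.
have gcI a b : (@lebesgue_measure R).-integrable `[a, b] (EFin \o gc).
  apply: continuous_compact_integrable; first exact: segment_compact.
  exact: continuous_subspaceT.
(* Integrating from -1 makes 0 an interior point, so that the derivative there is two-sided. *)
pose F t := \int[@lebesgue_measure R]_(s in `[-1, t]) gc s.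
have dF t : 0 <= t <= T -> is_derive t (1 : R) F (gc t).
  move=> /andP[t0 tT].
  have [||||dF1 dF2] := @continuous_FTC1_closed R gc (-1) t (t + 1).
  - by rewrite ltrDl.
  - exact: gcI.
  - by rewrite (lt_le_trans _ t0)// ltrN10.
  - exact: cgc.
  by rewrite derive1E in dF2; exact: DeriveDef dF1 dF2.
exists (fun t => F t - F 0); split; first by rewrite subrr.
  move=> t tT; have dFt := dF t tT; rewrite -[g t]subr0.
  have -> : g t = gc t by rewrite /gc clampE.
  exact: is_deriveB.
move=> t /andP[t0 tT]; rewrite /F.
transitivity (\int[@lebesgue_measure R]_(s in `[0, t]) gc s).
  apply: eq_Rintegral =>  s; rewrite inE /= in_itv /= => /andP[s0 st];
    rewrite /gc clampE//.
  by rewrite s0 (le_trans st).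
rewrite Rintegral_itvB.
- by rewrite Rintegral_itv_obnd_cbnd//; apply: integrableS (gcI 0 t) => //;
  exact: subset_itv_oc_cc.
- exact: gcI.
- by rewrite bnd_simp.
- by rewrite bnd_simp.
Qed.

Lemma has_deriv_ext T F f f' : (forall t, 0 <= t <= T -> f t = f' t) ->
  has_deriv T F f -> has_deriv T F f'.
Proof. by move=> ff' dF t tT; rewrite -ff'//; exact: dF. Qed.

Lemma has_deriv_congr T F F' f f' : F =1 F' -> f =1 f' ->
  has_deriv T F f -> has_deriv T F' f'.
Proof. by move=> /funext -> /funext ->. Qed.

Lemma has_derivD T F f G g : has_deriv T F f -> has_deriv T G g ->
  has_deriv T (fun t => F t + G t) (fun t => f t + g t).
Proof. by move=> dF dG t tT; have := dF t tT; have := dG t tT => *;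
  exact: is_deriveD. Qed.

Lemma has_derivN T F f : has_deriv T F f ->
  has_deriv T (fun t => - F t) (fun t => - f t).
Proof. by move=> dF t tT; have := dF t tT => *; exact: is_deriveN. Qed.

Lemma has_derivB T F f G g : has_deriv T F f -> has_deriv T G g ->
  has_deriv T (fun t => F t - G t) (fun t => f t - g t).
Proof. by move=> dF dG; apply: has_derivD => //; exact: has_derivN. Qed.

Lemma has_derivM T F f G g : has_deriv T F f -> has_deriv T G g ->
  has_deriv T (fun t => F t * G t) (fun t => F t * g t + G t * f t).
Proof. by move=> dF dG t tT; have := dF t tT; have := dG t tT => *;
  exact: is_deriveM. Qed.

Lemma has_deriv_cst T c : has_deriv T (fun=> c) (fun=> 0).
Proof. by move=> t _; exact: is_derive_cst. Qed.

Lemma has_derivZ T c F f : has_deriv T F f ->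
  has_deriv T (fun t => c * F t) (fun t => c * f t).
Proof.
move=> dF; apply: has_deriv_ext (has_derivM (@has_deriv_cst T c) dF) => t _.
by rewrite mulr0 addr0.
Qed.

Lemma has_deriv_id T : has_deriv T id (fun=> 1).
Proof. by move=> t _; exact: is_derive_id. Qed.

Lemma has_deriv_sum T n (F f : 'I_n -> R -> R) :
  (forall i, has_deriv T (F i) (f i)) ->
  has_deriv T (fun t => \sum_i F i t) (fun t => \sum_i f i t).
Proof.
move=> dF t tT; have dFt i := dF i t tT.
have -> : (fun t => \sum_i F i t) = \sum_i F i by apply/funext => s; rewrite fct_sumE.
exact: is_derive_sum.
Qed.

End calculus.

(** * Vector-valued functions of time *)

Section vector_calculus.
Context {R : realType} {n : nat}.
Implicit Types (T : R) (X D : R -> 'rV[R]_n).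

Lemma rV_norm_le (x : 'rV[R]_n) c : 0 <= c ->
  (forall i, `|x 0 i| <= c) -> `|x| <= c.
Proof.
move=> c0 h; rewrite /Num.norm/= mx_normrE; apply: bigmax_le => //= -[i j] _ /=.
by rewrite ord1.
Qed.

Lemma rV_coord_le (x : 'rV[R]_n) i : `|x 0 i| <= `|x|.
Proof.
rewrite [leRHS]/Num.norm/= mx_normrE.
exact: (le_bigmax _ (fun ij => `|x ij.1 ij.2|) (0, i)).
Qed.

(** Coordinatewise, so that in the sup norm every mean value estimate reduces to the scalar one. *)
Definition has_vderiv T X D :=
  forall i, has_deriv T (fun t => X t 0 i) (fun t => D t 0 i).

Lemma has_vderiv_ext T X D D' : (forall t, 0 <= t <= T -> D t = D' t) ->
  has_vderiv T X D -> has_vderiv T X D'.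
Proof. by move=> DD' dX i; apply: has_deriv_ext (dX i) => t /DD' ->. Qed.

Lemma has_vderivB T X D Y E : has_vderiv T X D -> has_vderiv T Y E ->
  has_vderiv T (fun t => X t - Y t) (fun t => D t - E t).
Proof.
by move=> dX dY i; apply: has_deriv_congr (has_derivB (dX i) (dY i)) => t;
   rewrite !mxE.
Qed.

Lemma has_vderiv_scale T (w v : R -> R) X D : has_deriv T w v ->
  has_vderiv T X D ->
  has_vderiv T (fun t => w t *: X t) (fun t => v t *: X t + w t *: D t).
Proof.
move=> dw dX i; apply: has_deriv_congr (has_derivM dw (dX i)) => t.
  by rewrite mxE.
by rewrite !mxE addrC [_ * v t]mulrC.
Qed.

Lemma has_vderiv_scalel T (w v : R -> R) (x : 'rV[R]_n) : has_deriv T w v ->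
  has_vderiv T (fun t => w t *: x) (fun t => v t *: x).
Proof.
by move=> dw i; apply: has_deriv_congr (has_derivZ (x 0 i) dw) => t;
   rewrite mxE mulrC.
Qed.

Lemma has_vderiv_mulmx T X D (M : 'M[R]_n) : has_vderiv T X D ->
  has_vderiv T (fun t => X t *m M) (fun t => D t *m M).
Proof.
move=> dX i.
apply: has_deriv_congr (has_deriv_sum (fun j => has_derivZ (M j i) (dX j))) => t;
  by rewrite mxE; apply: eq_bigr => j _; rewrite mulrC.
Qed.

Lemma has_vderiv_norm T X D G g : 0 <= T -> has_vderiv T X D ->
  has_deriv T G g -> (forall t, 0 <= t <= T -> `|D t| <= g t) ->
  forall t, 0 <= t <= T -> `|X t - X 0| <= G t - G 0.
Proof.
move=> T0 dX dG Dg t tT; apply: rV_norm_le.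
  rewrite subr_ge0; apply: (has_deriv_ge0 dG) tT => s sT.
  exact: le_trans (Dg s sT).
move=> i; rewrite !mxE; apply: (has_deriv_norm (dX i) dG) tT => s sT.
exact: le_trans (rV_coord_le _ _) (Dg s sT).
Qed.

Lemma has_vderiv_continuous T X D : has_vderiv T X D ->
  {in `[0, T]%R, continuous X}.
Proof.
move=> dX t; rewrite in_itv /= => tT; apply: differentiable_continuous.
apply/derivable1_diffP/derivable_mxP => i j; rewrite ord1.
by have := dX j t tT => ?; exact: ex_derive.
Qed.

Lemma has_vderiv_norm_within T X D : has_vderiv T X D ->
  {within `[0, T], continuous (fun t => `|X t|)}.
Proof.
move=> dX; apply: continuous_in_subspaceT => t; rewrite inE => tT.
by apply: continuous_comp;
  [exact: has_vderiv_continuous dX _ tT|exact: norm_continuous].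
Qed.

Lemma gronwall_small T K X D G g : 0 <= T -> 0 <= K -> K * T <= 2^-1 ->
  has_vderiv T X D -> X 0 = 0 -> has_deriv T G g -> G 0 = 0 ->
  (forall t, 0 <= t <= T -> 0 <= g t) ->
  (forall t, 0 <= t <= T -> `|D t| <= K * `|X t| + g t) ->
  forall t, 0 <= t <= T -> `|X t| <= 2 * G T.
Proof.
move=> T0 K0 KT dX X0 dG G0 g0 Dle t tT.
have [s] := EVT_max T0 (has_vderiv_norm_within dX).
rewrite in_itv /= => sT smax.
have TT : 0 <= T <= T by rewrite T0 lexx.
have GsT : G s <= G T.
  by case/andP: (sT) => s0 s1; exact: has_deriv_homo dG g0 _ _ s0 s1 (lexx T).
have : `|X s - X 0| <= (K * `|X s| * s + G s) - (K * `|X s| * 0 + G 0).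
  apply: (has_vderiv_norm (T := T) (G := fun r => K * `|X s| * r + G r)
    (g := fun r => K * `|X s| * 1 + g r) T0 dX) sT.
    by apply: has_derivD => //; apply: has_derivZ; exact: has_deriv_id.
  move=> r rT; rewrite (le_trans (Dle r rT))// lerD2r mulr1 ler_wpM2l// smax//.
rewrite X0 G0 subr0 mulr0 addr0 subr0 => h.
have := smax t; rewrite in_itv /= => /(_ tT) ts.
have : K * `|X s| * s <= 2^-1 * `|X s|.
  rewrite mulrAC ler_wpM2r//; apply: le_trans KT.
  by rewrite ler_wpM2l//; case/andP: sT.
by move: h ts GsT; lra.
Qed.

End vector_calculus.

(** * Interpolation *)

Section interpolation.
Context {R : realType}.

(** Induction on [N]. The top inequality bounds [G N.+1] through [G N]; the induction hypothesis is
    taken with d / 4, so that [G N.+1] comes back with coefficient 1/2 and is absorbed. *)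
Lemma landau_seq (N : nat) (eps : R) : 0 < eps ->
  exists2 C : R, 0 <= C & forall G : nat -> R, (forall j, 0 <= G j) ->
    (forall d j, 0 < d -> d <= 1 -> (j.+2 <= N.+1)%N ->
       G j.+1 <= 2 / d * G j + d * G j.+2) ->
    forall j, (j <= N)%N -> G j <= C * G 0%N + eps * G N.+1.
Proof.
elim: N eps => [|N IH] eps e0.
  exists 1 => // G G0 _ [|//] _; rewrite mul1r lerDl mulr_ge0 ?G0 ?ltW//.
pose d : R := Num.min 1 (eps / 2).
have d0 : 0 < d by rewrite /d lt_min ltr01 divr_gt0.
have d1 : d <= 1 by rewrite /d ge_min lexx.
have de : d * 2 <= eps by rewrite -ler_pdivlMr// /d ge_min lexx orbT.
have [C C0 HC] := IH (d / 4) (divr_gt0 d0 (ltr0n _ 4)).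
have Cd0 : 0 <= 4 * C / d by apply: divr_ge0; [exact: mulr_ge0|exact: ltW].
exists (C + 4 * C / d) => [|G G0 HG j jN]; first exact: addr_ge0.
have {}HC := HC G G0 (fun d j d0 d1 jN => HG d j d0 d1 (leqW jN)).
have GN : G N.+1 <= 4 * C / d * G 0%N + eps * G N.+2.
  have h1 := HG d N d0 d1 (leqnn _).
  have h2 : 2 / d * G N <= 2 / d * (C * G 0%N + d / 4 * G N.+1).
    by rewrite ler_wpM2l ?HC// divr_ge0// ltW.
  have E : 2 / d * (C * G 0%N + d / 4 * G N.+1) =
    2^-1 * (4 * C / d * G 0%N) + 2^-1 * G N.+1 by field; rewrite gt_eqF.
  have h3 : d * 2 * G N.+2 <= eps * G N.+2 by rewrite ler_wpM2r.
  by move: h1 h2 h3; rewrite E; lra.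
move: jN; rewrite leq_eqVlt => /predU1P[->|].
  by rewrite (le_trans GN)// lerD2r ler_wpM2r// lerDr.
rewrite ltnS => jN; apply: le_trans (HC j jN) _.
have h3 : d / 4 * G N.+1 <= G N.+1.
  by rewrite ler_piMl// ler_pdivrMr// mul1r (le_trans d1)// ler1n.
by move: GN; rewrite mulrDl; lra.
Qed.

Lemma is_derive_mull (c x df : R) (F : R -> R) : is_derive x (1 : R) F df ->
  is_derive x (1 : R) (fun y => c * F y) (c * df).
Proof.
move=> dF; apply: is_derive_eq (is_deriveM (is_derive_cst c x 1) dF) _.
by rewrite scaler0 addr0.
Qed.

(** Counterpart of [has_deriv_homo] for derivatives known only inside the interval, as is the case
    for those of a control. *)
Lemma open_homo (a b : R) (F f : R -> R) : a <= b ->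
  {within `[a, b], continuous F} ->
  (forall x, a < x < b -> is_derive x (1 : R) F (f x)) ->
  (forall x, a < x < b -> 0 <= f x) -> F a <= F b.
Proof.
rewrite le_eqVlt => /predU1P[-> //|ab] cF dF f0.
have dF' x : x \in `]a, b[%R -> is_derive x (1 : R) F (f x).
  by rewrite in_itv; exact: dF.
have [c cab E] := MVT ab dF' cF.
have fc : 0 <= f c by apply: f0; move: cab; rewrite in_itv.
by rewrite -subr_ge0 E mulr_ge0// subr_ge0 ltW.
Qed.

Lemma open_norm (a b : R) (F f G g : R -> R) : a <= b ->
  {within `[a, b], continuous F} -> {within `[a, b], continuous G} ->
  (forall x, a < x < b -> is_derive x (1 : R) F (f x)) ->
  (forall x, a < x < b -> is_derive x (1 : R) G (g x)) ->
  (forall x, a < x < b -> `|f x| <= g x) -> `|F b - F a| <= G b - G a.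
Proof.
move=> ab cF cG dF dG fg; rewrite ler_norml; apply/andP; split.
  have : (F + G) a <= (F + G) b.
    apply: (open_homo (f := f + g)) => //.
    - exact: within_continuousD.
    - by move=> x xab; have := dF x xab; have := dG x xab => *; exact: is_deriveD.
    - move=> x /fg; rewrite ler_norml => /andP[]; rewrite fctE; lra.
  by rewrite !fctE; lra.
have : (G - F) a <= (G - F) b.
  apply: (open_homo (f := g - f)) => //.
  - exact: within_continuousB.
  - by move=> x xab; have := dF x xab; have := dG x xab => *; exact: is_deriveB.
  - move=> x /fg; rewrite ler_norml => /andP[]; rewrite !fctE; lra.
by rewrite !fctE; lra.
Qed.

Lemma within_continuousM (A : set R) (f g : R -> R) :
  {within A, continuous f} -> {within A, continuous g} ->
  {within A, continuous (fun x => f x * g x)}.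
Proof. by move=> cf cg x; apply: cvgM; [exact: cf|exact: cg]. Qed.

(** As h <= T / 4, a segment of length [h] with end point [t] fits inside the open interval, to the
    right or to the left. By the mean value theorem |g1| <= 2 S / h somewhere on it, and [g1] varies
    by at most h S2 along it. *)
Lemma landau_step (T h S S2 : R) (g g1 g2 : R -> R) : 0 < h -> h <= T / 4 ->
  (forall t, 0 < t < T -> is_derive t (1 : R) g (g1 t)) ->
  (forall t, 0 < t < T -> is_derive t (1 : R) g1 (g2 t)) ->
  (forall t, 0 < t < T -> `|g t| <= S) ->
  (forall t, 0 < t < T -> `|g2 t| <= S2) ->
  forall t, 0 < t < T -> `|g1 t| <= 2 / h * S + h * S2.
Proof.
move=> h0 hT dg dg1 gS g2S t t0T.
have sub (a b x : R) : 0 < a -> b < T -> a <= x <= b -> 0 < x < T by lra.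
have [a [a0 aT aht]] : exists a, [/\ 0 < a, a + h < T & a <= t <= a + h].
  case: (leP t (T / 2)) => tT; [exists t|exists (t - h)]; split; lra.
have cw (F f : R -> R) b c : 0 < b -> c < T ->
    (forall t, 0 < t < T -> is_derive t (1 : R) F (f t)) ->
    {within `[b, c], continuous F}.
  move=> b0 cT dF; apply: derivable_within_continuous => x.
  by rewrite in_itv /= => /(sub _ _ _ b0 cT)/dF ?; exact: ex_derive.
have dg' x : x \in `]a, (a + h)[%R -> is_derive x (1 : R) g (g1 x).
  by rewrite in_itv /= => xah; apply: dg; lra.
have aah : a < a + h by rewrite ltrDl.
have [c cin E] := MVT aah dg' (cw _ _ _ _ a0 aT dg).
move: cin; rewrite in_itv /= => cin.
have bd p q : 0 < p -> p <= q -> q < T -> `|g1 q - g1 p| <= S2 * (q - p).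
  move=> p0 pq qT; rewrite mulrBr.
  apply: (open_norm (g := fun=> S2 * 1) (G := fun x => S2 * x) (f := g2)) => //.
  - exact: cw dg1.
  - apply: continuous_subspaceT => x; apply: continuousM => //; exact: cst_continuous.
  - by move=> x xpq; apply: dg1; lra.
  - by move=> x xpq; rewrite mulr1 g2S//; lra.
have S20 : 0 <= S2 by exact: le_trans (g2S t t0T).
have b1 : `|g1 t - g1 c| <= h * S2.
  case: (leP c t) => ct.
    by apply: le_trans (bd _ _ _ ct _) _; [lra|lra|rewrite mulrC ler_wpM2r//; lra].
  rewrite distrC.
  by apply: le_trans (bd _ _ _ (ltW ct) _) _; [lra|lra|rewrite mulrC ler_wpM2r//;
    lra].
have b2 : `|g1 c| <= 2 / h * S.
  have : `|g1 c * h| <= 2 * S.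
    move: E; rewrite addrAC subrr add0r => <-.
    by apply: le_trans (ler_normB _ _) _; rewrite mulr_natl mulr2n lerD// gS//; lra.
  by rewrite normrM (gtr0_norm h0) -ler_pdivlMr// mulrAC.
rewrite -(subrK (g1 c) (g1 t)) (le_trans (ler_normD _ _))// addrC.
exact: lerD.
Qed.

(* Differentiating [t v^3] on [[0, t]] and [(T - t) v^3] on [[t, T]] avoids any
   information on the boundary values of [v]. *)
Lemma cube_le (T S S1 : R) (v v1 W : R -> R) : 0 <= T ->
  {within `[0, T], continuous v} ->
  (forall t, 0 < t < T -> is_derive t (1 : R) v (v1 t)) ->
  (forall t, 0 < t < T -> `|v t| <= S) ->
  (forall t, 0 < t < T -> `|v1 t| <= S1) ->
  has_deriv T W (fun t => v t ^+ 2) -> W 0 = 0 ->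
  forall t, 0 < t < T -> T * `|v t| ^+ 3 <= (S + 3 * T * S1) * W T.
Proof.
move=> T0 cv dv vS v1S dW W0 t t0T.
set kp := S + 3 * T * S1.
have cW a b : 0 <= a -> b <= T -> {within `[a, b], continuous (fun x => kp * W x)}.
  move=> a0 bT; apply: derivable_within_continuous => x; rewrite in_itv /= => xab.
  have xT : 0 <= x <= T by lra.
  by have := is_derive_mull kp (dW _ xT) => ?; exact: ex_derive.
have cvab a b : 0 <= a -> b <= T -> {within `[a, b], continuous v}.
  move=> a0 bT; apply: continuous_subspaceW cv => x /=; rewrite !in_itv /=; lra.
have dkW x : 0 < x < T -> is_derive x (1 : R) (fun x => kp * W x) (kp * v x ^+ 2).
  move=> xT; have xT' : 0 <= x <= T by lra.
  by have := is_derive_mull kp (dW _ xT').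
(* The weight c + s x covers both cases: x for (c, s) = (0, 1), and T - x for (c, s) = (T, -1). *)
have main (c : R) (s : R) : 0 <= c <= T -> `|s| = 1 -> forall a b, 0 <= a ->
  a <= b -> b <= T ->
   (forall x, a < x < b -> `|c + s * x| <= T) ->
   `|(c + s * b) * v b ^+ 3 - (c + s * a) * v a ^+ 3| <= kp * W b - kp * W a.
  move=> cT s1 a b a0 ab bT xT.
  apply: (open_norm (F := fun x => (c + s * x) * v x ^+ 3)
    (f := fun x => (c + s * x) * (3 * v x ^+ 2 * v1 x) + v x ^+ 3 * s)
    (G := fun x => kp * W x) (g := fun x => kp * v x ^+ 2)).
  - exact: ab.
  - have cx := cvab a b a0 bT.
    apply: within_continuousM.
      apply: continuous_subspaceT => y; apply: continuousD;
        first exact: cst_continuous.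
      by apply: continuousM => //; exact: cst_continuous.
    have -> : (fun x => v x ^+ 3) = (fun x => v x * (v x * v x)).
      by apply/funext => y; rewrite !exprS expr0 mulr1.
    by apply: within_continuousM => //; apply: within_continuousM.
  - exact: cW.
  - move=> x xab; have dvx : is_derive x (1 : R) v (v1 x) by apply: dv; lra.
    have d1 : is_derive x (1 : R) (fun x => c + s * x) (0 + s * 1).
      exact: is_deriveD (is_derive_cst c x 1) (is_derive_mull s (is_derive_id x 1)).
    have d2 : is_derive x (1 : R) (fun x => v x ^+ 3) (3 * v x ^+ 2 * v1 x).
      have -> : (fun x => v x ^+ 3) = v * (v * v).
        by apply/funext => y; rewrite !exprS expr0 mulr1.
      apply: is_derive_eq (is_deriveM dvx (is_deriveM dvx dvx)) _.
      by rewrite /GRing.scale /= fctE; ring.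
    apply: is_derive_eq (is_deriveM d1 d2) _.
    by rewrite /GRing.scale /=; ring.
  - by move=> x xab; apply: dkW; lra.
  - move=> x xab; have x0T : 0 < x < T by lra.
    have E : (c + s * x) * (3 * v x ^+ 2 * v1 x) + v x ^+ 3 * s =
      v x ^+ 2 * (v x * s + 3 * (c + s * x) * v1 x) by ring.
    rewrite E normrM (ger0_norm (sqr_ge0 (v x))) mulrC ler_wpM2r ?sqr_ge0//.
    rewrite (le_trans (ler_normD _ _))// lerD//.
      by rewrite normrM s1 mulr1 vS.
    by rewrite !normrM ger0_norm// ler_pM ?mulr_ge0 ?ler_wpM2l ?xT ?v1S.
have h1 : `|t * v t ^+ 3| <= kp * W t.
  have := main 0 1 _ (normr1 _) 0 t (lexx _) _ _ _.
  rewrite !add0r !mul1r mul0r W0 mulr0 !subr0; apply; try lra.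
  by move=> x xt; rewrite add0r mul1r gtr0_norm; lra.
have h2 : `|(T - t) * v t ^+ 3| <= kp * W T - kp * W t.
  have := main T (-1) _ (normrN1 _) t T _ _ _ _.
  rewrite !mulN1r subrr mul0r sub0r normrN; apply; try lra.
  by move=> x xt; rewrite mulN1r ger0_norm; lra.
have t0 : 0 < t by lra.
have tT : 0 <= T - t by lra.
move: h1 h2; rewrite normrM (gtr0_norm t0) normrX => h1.
by rewrite normrM (ger0_norm tT) normrX; lra.
Qed.

(* [h] is chosen so that [h ^+ N] is the sup of the lowest function: every
   rescaled derivative [h ^+ j * sup |g j|] is then at most [(C + 1) * h ^+ N]. *)
Lemma interpolation (k : nat) (T eps : R) : 0 < T -> T <= 1 -> 0 < eps ->
  exists2 eta : R, 0 < eta & forall (g : nat -> R -> R) (W : R -> R),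
    (forall j, (j < 3 * k + 2)%N -> forall t, 0 < t < T ->
       is_derive t (1 : R) (g j) (g j.+1 t)) ->
    (forall j, (j <= 3 * k + 2)%N -> forall t, 0 < t < T -> `|g j t| <= eta) ->
    {within `[0, T], continuous (g 0%N)} ->
    has_deriv T W (fun t => g 0%N t ^+ 2) -> W 0 = 0 ->
    forall t, 0 < t < T -> `|g k t| ^+ 3 <= eps * W T.
Proof.
(* This [N] satisfies 3 (N - k) = 2 N + 2. When h^N is the sup of |g 0|, [cube_le] gives h^(2 N + 1)
   = O(W T), while |g k|^3 = O(h^(2 N + 2)), with constants depending on [T]. The one spare factor
   [h] provides [eps]. *)
move=> T0 T1 e0; set N := (3 * k + 2)%N.
have NE : N = N.-1.+1 by rewrite /N addn2.
have [C C0 HC] := landau_seq N.-1 ltr01.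
pose D := C + 1; have D1 : 1 <= D by rewrite lerDr.
have D0 : 0 < D by exact: lt_le_trans D1.
pose K := D ^+ 3 * (4 * D) / T.
have K0 : 0 < K by rewrite divr_gt0// mulr_gt0 ?exprn_gt0// mulr_gt0.
pose h0 := Num.min (T / 4) (eps / K).
have h00 : 0 < h0 by rewrite lt_min; apply/andP; split; exact: divr_gt0.
have h0T : h0 <= T / 4 by rewrite ge_min lexx.
have h0e : K * h0 <= eps by rewrite mulrC -ler_pdivlMr// ge_min lexx orbT.
(* The bound 1 is for the top derivative, [S N]; the bound h0^N is for [S 0] and forces h <= h0. *)
exists (Num.min 1 (h0 ^+ N)); first by rewrite lt_min ltr01 exprn_gt0.
move=> g W dg gle cg dW W0.
have TT : 0 <= T <= T by rewrite lexx ltW.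
have WT0 : 0 <= W T.
  by rewrite -W0; apply: (has_deriv_ge0 dW) TT => t _; exact: sqr_ge0.
pose S j := sup [set `|g j t| | t in [set t | 0 < t < T]].
have mid : 0 < T / 2 < T by lra.
have hasS j : (j <= N)%N -> has_sup [set `|g j t| | t in [set t | 0 < t < T]].
  move=> jN; split; first by exists `|g j (T / 2)|, (T / 2).
  by exists (Num.min 1 (h0 ^+ N)) => _ [t tT <-]; exact: gle.
have gS j t : (j <= N)%N -> 0 < t < T -> `|g j t| <= S j.
  by move=> jN tT; apply: sup_upper_bound; [exact: hasS|exists t].
have Sle j c : (j <= N)%N -> (forall t, 0 < t < T -> `|g j t| <= c) -> S j <= c.
  move=> jN gc; apply: ge_sup; first by case: (hasS j jN).
  by move=> _ [t tT <-]; exact: gc.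
have S0 j : (j <= N)%N -> 0 <= S j by move=> jN; exact: le_trans (gS j _ jN mid).
have SN1 : S N <= 1.
  by apply: Sle => // t tT; rewrite (le_trans (gle _ _ _ tT))// ge_min lexx.
have S0h : S 0%N <= h0 ^+ N.
  by apply: Sle => // t tT; rewrite (le_trans (gle _ _ _ tT))// ge_min lexx orbT.
(* Weighting the j-th sup by h^j turns the Landau step h d into the step d, so the same [C] serves
   for every [h]. *)
have scaled h : 0 < h -> h <= T / 4 -> forall j, (j < N)%N ->
    h ^+ j * S j <= C * S 0%N + h ^+ N.
  move=> hp hT j jN.
  pose G j := if (j <= N)%N then h ^+ j * S j else 0.
  have G0 i : 0 <= G i.
    by rewrite /G; case: ifP => // iN; rewrite mulr_ge0 ?S0 ?exprn_ge0 ?ltW.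
  have HG d i : 0 < d -> d <= 1 -> (i.+2 <= N.-1.+1)%N ->
      G i.+1 <= 2 / d * G i + d * G i.+2.
    move=> d0 d1; rewrite -NE => iN.
    rewrite /G iN (ltnW iN) (ltnW (ltnW iN)).
    have hd : h * d <= T / 4 by rewrite (le_trans _ hT)// ler_piMr// ltW.
    have hd0 : 0 < h * d by rewrite mulr_gt0.
    have step : S i.+1 <= 2 / (h * d) * S i + h * d * S i.+2.
      apply: Sle; first exact: ltnW.
      apply: (landau_step hd0 hd (dg i (ltnW iN)) (dg i.+1 iN)) => t tT.
        by apply: gS => //; exact: ltnW (ltnW iN).
      exact: gS.
    rewrite -(ler_pM2l (exprn_gt0 i.+1 hp)) in step; apply: le_trans step _.
    rewrite le_eqVlt; apply/orP; left; apply/eqP; rewrite !exprS; field.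
    by rewrite !gt_eqF.
  have jN' : (j <= N.-1)%N by rewrite -ltnS -NE.
  have := HC G G0 HG j jN';
    rewrite -NE /G (ltnW jN) leqnn leq0n expr0 !mul1r => /le_trans; apply.
  by rewrite lerD2l ler_piMr// exprn_ge0// ltW.
move=> t tT.
have Nk : (N - k = 2 * k + 2)%N by rewrite /N mulSn -addnA addKn.
have kN : (k < N)%N by rewrite -subn_gt0 Nk addn2.
have N1 : (1 < N)%N by rewrite /N addn2.
(* If [g 0] vanishes it fixes no scale: [h] is then arbitrary, and S k <= h^(N - k) gives [S k] = 0
   in the limit. *)
have [S0z|S0nz] := eqVneq (S 0%N) 0.
  suff -> : g k t = 0 by rewrite normr0 expr0n mulr_ge0// ltW.
  apply/eqP; rewrite -normr_eq0 eq_le normr_ge0 andbT.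
  apply/ler_addgt0Pl => r r0; rewrite addr0.
  pose h := Num.min (T / 4) r.
  have hp : 0 < h by rewrite lt_min r0 divr_gt0.
  have h1 : h <= 1 by rewrite ge_min; apply/orP; left; lra.
  have := scaled h hp _ k kN; rewrite S0z mulr0 add0r ge_min lexx => /(_ isT).
  rewrite -(subnKC (ltnW kN)) exprD ler_pM2l ?exprn_gt0// => Sk.
  apply: le_trans (gS k t (ltnW kN) tT) _; apply: le_trans Sk _.
  have : (0 < N - k)%N by rewrite subn_gt0.
  case: (N - k)%N => // m _; rewrite exprS.
  apply: (@le_trans _ _ h); last by rewrite ge_min lexx orbT.
  by rewrite ler_piMr ?(ltW hp)// exprn_ile1// ltW.
pose h := S 0%N `^ (N%:R^-1).
have Sp : 0 < S 0%N by rewrite lt_neqAle eq_sym S0nz S0.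
have hp : 0 < h by exact: powR_gt0.
have hN : h ^+ N = S 0%N.
  rewrite -powR_mulrn ?powR_ge0// -powRrM mulVf ?powRr1 ?S0//.
  by rewrite pnatr_eq0 NE.
have hh0 : h <= h0.
  by rewrite -(ler_pXn2r (ltnW N1)) ?nnegrE ?(ltW hp) ?(ltW h00)// hN.
have hT := le_trans hh0 h0T.
have h1 : h <= 1 by lra.
have scaledD j : (j < N)%N -> S j <= D * h ^+ (N - j).
  move=> jN; have := scaled h hp hT j jN.
  have -> : C * S 0%N + h ^+ N = h ^+ j * (D * h ^+ (N - j)).
    by rewrite -hN mulrCA -exprD (subnKC (ltnW jN)) /D mulrDl mul1r.
  by rewrite ler_pM2l ?exprn_gt0.
have cube s : 0 < s < T -> T * `|g 0%N s| ^+ 3 <= (4 * D * h ^+ N.-1) * W T.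
  move=> sT.
  have N0 := ltnW N1.
  apply: le_trans (cube_le (ltW T0) cg (dg 0%N N0) (fun t => gS 0%N t (leq0n _))
     (fun t => gS 1%N t N0) dW W0 sT) _.
  rewrite ler_wpM2r//.
  have := scaledD 1%N N1; rewrite subn1 => S1.
  have : S 0%N <= D * h ^+ N.-1.
    rewrite -hN NE exprS /= ler_wpM2r ?exprn_ge0 ?(ltW hp)//.
    exact: le_trans h1 _.
  have : T * S 1%N <= S 1%N by rewrite ler_piMl// S0// ltnW.
  by move: S1; lra.
have {}cube : T * S 0%N ^+ 3 <= (4 * D * h ^+ N.-1) * W T.
  rewrite mulrC -ler_pdivlMr//.
  set B := _ / T.
  have B0 : 0 <= B.
    by rewrite /B divr_ge0 ?(ltW T0)// !mulr_ge0 ?exprn_ge0 ?(ltW D0) ?(ltW hp).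
  have BE : B = (B `^ (3%:R^-1)) ^+ 3.
    by rewrite -powR_mulrn ?powR_ge0// -powRrM mulVf ?powRr1.
  rewrite BE ler_pXn2r ?nnegrE ?powR_ge0 ?S0//.
  apply: Sle => // s sT; rewrite -(@ler_pXn2r _ 3)// ?nnegrE ?powR_ge0//.
  by rewrite -BE ler_pdivlMr// mulrC cube.
have gk3 : `|g k t| ^+ 3 <= (D * h ^+ (N - k)) ^+ 3.
  rewrite ler_pXn2r ?nnegrE ?mulr_ge0 ?exprn_ge0 ?(ltW D0) ?(ltW hp)//.
  exact: le_trans (gS k t (ltnW kN) tT) (scaledD k kN).
apply: le_trans gk3 _.
have NE2 : (3 * (N - k) = (2 * N + 1) + 1)%N by rewrite Nk /N; ring.
have NE3 : (3 * N = (2 * N + 1) + N.-1)%N by rewrite NE /= -[N.-1.+1]addn1; ring.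
have hh : h ^+ (2 * N + 1) * T <= 4 * D * W T.
  rewrite -(ler_pM2r (exprn_gt0 N.-1 hp)) mulrAC -exprD -NE3 mulnC exprM hN mulrC.
  by rewrite (le_trans cube)// mulrAC.
rewrite exprMn -exprM mulnC NE2 exprD expr1.
have -> : D ^+ 3 * (h ^+ (2 * N + 1) * h) = D ^+ 3 * (h ^+ (2 * N + 1) * T) / T * h.
  by field; rewrite gt_eqF.
apply: (@le_trans _ _ (K * h * W T)); last first.
  by rewrite ler_wpM2r// (le_trans _ h0e)// ler_pM2l.
have -> : K * h * W T = D ^+ 3 * (4 * D * W T) / T * h by rewrite /K; field;
  rewrite gt_eqF.
by rewrite ler_pM2r// ler_pM2r ?invr_gt0// ler_pM2l// exprn_gt0.
Qed.

End interpolation.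

(** * Second order normal form along a trajectory *)

Section bounds.
Context {R : realType} {n : nat}.
Implicit Types (x y : 'rV[R]_n) (M : 'M[R]_n).

Definition mx_l1 M : R := \sum_i \sum_j `|M i j|.

Lemma mx_l1_ge0 M : 0 <= mx_l1 M.
Proof. by apply: sumr_ge0 => i _; apply: sumr_ge0. Qed.

Lemma mulmx_norm_le x M : `|x *m M| <= mx_l1 M * `|x|.
Proof.
apply: rV_norm_le => [|j]; first by rewrite mulr_ge0 ?mx_l1_ge0.
rewrite mxE; apply: le_trans (ler_norm_sum _ _ _) _.
rewrite mulr_suml; apply: ler_sum => i _; rewrite normrM mulrC.
apply: ler_pM => //; last exact: rV_coord_le.
by rewrite (bigD1 j)//= lerDl sumr_ge0.
Qed.

Variable Phi : 'rV[R]_n -> 'M[R]_n.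
Hypothesis Phi_sym : forall x y, x *m Phi y = y *m Phi x.

(** [Phi] is not assumed linear: symmetry moves [x] to the left of the matrix, where it can be
    expanded in the canonical basis. *)
Lemma bilinear_norm_le : exists2 C : R, 0 <= C &
  forall x y, `|y *m Phi x| <= C * `|x| * `|y|.
Proof.
exists (\sum_i mx_l1 (Phi (delta_mx 0 i))).
  by apply: sumr_ge0 => i _; exact: mx_l1_ge0.
move=> x y; rewrite -Phi_sym {1}(row_sum_delta x) mulmx_suml !mulr_suml.
apply: le_trans (ler_norm_sum _ _ _) _; apply: ler_sum => i _.
rewrite -scalemxAl Phi_sym normrZ -mulrA [_ * (_ * _)]mulrCA.
by apply: ler_pM => //; [exact: rV_coord_le|exact: mulmx_norm_le].
Qed.

End bounds.

(** The integral of (a - v)^2 is nonnegative when [a] is the mean of [v]. *)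
Lemma cauchy_schwarz_primitive {R : realType} (T : R) (v I W : R -> R) : 0 < T ->
  has_deriv T I v -> has_deriv T W (fun t => v t ^+ 2) -> I 0 = 0 -> W 0 = 0 ->
  I T ^+ 2 <= T * W T.
Proof.
move=> T0 dI dW I0 W0; set a := I T / T.
have d : has_deriv T (fun t => (a ^+ 2 * t + W t) - 2 * a * I t)
    (fun t => (a ^+ 2 * 1 + v t ^+ 2) - 2 * a * v t).
  apply: has_derivB; last exact: has_derivZ.
  by apply: has_derivD => //; apply: has_derivZ; exact: has_deriv_id.
have TT : 0 <= T <= T by rewrite lexx ltW.
have /= := has_deriv_ge0 d _ TT; rewrite I0 W0 !mulr0 addr0 subr0 => h.
have {}h : 0 <= a ^+ 2 * T + W T - 2 * a * I T.
  apply: h => t _; have ->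
    : a ^+ 2 * 1 + v t ^+ 2 - 2 * a * v t = (a - v t) ^+ 2 by ring.
  exact: sqr_ge0.
have E : (a ^+ 2 * T + W T - 2 * a * I T) * T = T * W T - I T ^+ 2.
  by rewrite /a; field; rewrite gt_eqF.
by rewrite -subr_ge0 -E mulr_ge0// ltW.
Qed.

(** Continuation argument, since [D] is controlled only while |X| <= r. If |X| reached some c > U,
    then up to the first such time |D| <= K c, so that |X| <= c / 2 at that time. *)
Lemma apriori_bound {R : realType} {n : nat} (K T U r : R) (X D : R -> 'rV[R]_n) :
  0 <= T -> 0 <= K -> K * T <= 2^-1 -> 0 <= U -> U < r ->
  has_vderiv T X D -> X 0 = 0 ->
  (forall t c, 0 <= t <= T -> U <= c -> c <= r -> `|X t| <= c -> `|D t| <= K * c) ->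
  forall t, 0 <= t <= T -> `|X t| <= U.
Proof.
move=> T0 K0 KT U0 Ur dX X0 Dle.
have main c : U < c -> c <= r -> forall t, 0 <= t <= T -> `|X t| < c.
  move=> Uc cr t tT; rewrite ltNge; apply/negP => ct.
  have c0 : 0 < c by exact: le_lt_trans Uc.
  pose g s := `|X (Num.max 0 (Num.min T s))|.
  have cg : continuous g := clamp_continuous T0 (has_vderiv_norm_within dX).
  pose E := `[0, T]%classic `&` g @^-1` [set z | c <= z].
  have cE : compact E.
    apply: compact_closedI; first exact: segment_compact.
    by apply: closed_comp => [s _|]; [exact: cg|exact: closed_ge].
  have gE s : 0 <= s <= T -> g s = `|X s| by move=> sT; rewrite /g clampE.
  have E0 : E !=set0 by exists t; split; rewrite /= ?in_itv//= gE.
  have cid : {within E, continuous (id : R -> R)}.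
    by apply: continuous_subspaceT => y; exact: cvg_id.
  (* The first such time is the minimum of the identity over a compact set of times. *)
  have [s] := compact_EVT_min E0 cE cid.
  rewrite inE /E /= in_itv /= => -[sT]; rewrite gE// => cs smin.
  have sT2 := andP sT; case: sT2 => s0 sT2.
  suff : `|X s - X 0| <= K * c * s.
    rewrite X0 subr0 => h; move: (le_trans cs h); apply/negP; rewrite -ltNge.
    rewrite mulrAC; apply: (@le_lt_trans _ _ (2^-1 * c)); last by lra.
    by rewrite ler_pM2r// (le_trans _ KT)// ler_wpM2l.
  apply: rV_norm_le => [|i]; first by rewrite !mulr_ge0// ltW.
  rewrite !mxE.
  have inT x : 0 < x < s -> 0 <= x <= T by lra.
  have -> : K * c * s = K * c * s - K * c * 0 by rewrite mulr0 subr0.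
  apply: (open_norm (F := fun t => X t 0 i) (f := fun t => D t 0 i)
    (G := fun t => K * c * t) (g := fun=> K * c * 1) s0).
  - apply: derivable_within_continuous => x; rewrite in_itv /= => xs.
    have xT : 0 <= x <= T by lra.
    by have := dX i x xT => ?; exact: ex_derive.
  - apply: derivable_within_continuous => x _.
    by have := is_derive_mull (K * c) (is_derive_id x 1) => ?; exact: ex_derive.
  - by move=> x /inT; exact: dX.
  - move=> x xs; rewrite mulr1; apply: le_trans (rV_coord_le _ _) _.
    apply: Dle => //; [exact: inT|exact: ltW|].
    rewrite leNgt; apply/negP => cx; have xT := inT _ xs.
    suff : s <= x by lra.
    by apply: smin; rewrite inE; split; rewrite /= ?in_itv//= gE// ltW.
move=> t tT; apply/ler_addgt0Pr => e e0.
apply: (@le_trans _ _ (Num.min r (U + e))); last by rewrite ge_min lexx orbT.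
by apply/ltW/main => //; rewrite ?ge_min ?lexx// lt_min Ur ltrDl.
Qed.

(** * Integrations by parts in a system expanded to second order *)

Section quadratic_normal_form.
Context {R : realType} {n : nat}.
Variables (A H : 'M[R]_n) (b q : 'rV[R]_n) (Phi : 'rV[R]_n -> 'M[R]_n).
Hypothesis Phi_sym : forall x y, x *m Phi y = y *m Phi x.

Fixpoint kal (i : nat) : 'rV[R]_n := if i is i'.+1 then kal i' *m A else b.

(* Up to the sign [(-1)^i], [kal i] and [jac i] are the value and the derivative
   at the origin of the [i]-fold bracket of [f1] with [f0], and [drift i] is [d_i]. *)
Fixpoint jac (i : nat) : 'M[R]_n :=
  if i is i'.+1 then jac i' *m A - A *m jac i' + Phi (kal i') else H.

Definition drift (i : nat) : 'rV[R]_n :=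
  if i is i'.+1 then kal i' *m jac i - kal i *m jac i' else q.

Definition quad (x : 'rV[R]_n) (u : R) : 'rV[R]_n :=
  2^-1 *: (x *m Phi x) + u *: (x *m H) + (u ^+ 2 / 2) *: q.

Section along.
Variables (T : R) (x D : R -> 'rV[R]_n) (ph : nat -> R -> R).
Hypothesis dx : has_vderiv T x D.
Hypothesis dph : forall j, has_deriv T (ph j.+1) (ph j).

(* [ph j] stands for the [j]-th primitive of the control [ph 0]. *)
Definition lin_rem t := D t - x t *m A - ph 0%N t *: b.
Definition quad_rem t := lin_rem t - quad (x t) (ph 0%N t).

(** Subtracting the terms ph_(i+1) b_i leaves a state that is driven by the [j]-th primitive instead
    of the control. *)
Fixpoint rho (j : nat) (t : R) : 'rV[R]_n :=
  if j is j'.+1 then rho j' t - ph j t *: kal j' else x t.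

Lemma rho_deriv j :
  has_vderiv T (rho j) (fun t => rho j t *m A + ph j t *: kal j + lin_rem t).
Proof.
elim: j => [|j IH].
  apply: has_vderiv_ext dx => t _.
  by apply/rowP => i; rewrite /= /lin_rem !mxE; ring.
apply: has_vderiv_ext (has_vderivB IH (has_vderiv_scalel (kal j) (dph j))) => t _ /=.
rewrite mulmxBl -scalemxAl.
set a1 := rho j t *m A; set a2 := kal j *m A.
by apply/rowP => i; rewrite !mxE; ring.
Qed.

(* Integration by parts: the [j]-th normal form absorbs the boundary terms, and
   its equation involves the control only through [ph j] and pure squares. *)
Fixpoint nf (j : nat) (t : R) : 'rV[R]_n :=
  if j is j'.+1 then
    nf j' t - ph j t *: (rho j t *m jac j') - (ph j t ^+ 2 / 2) *: (kal j' *m jac j')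
  else x t.

Fixpoint nf_rem (j : nat) (t : R) : 'rV[R]_n :=
  if j is j'.+1 then nf_rem j' t - ph j t *: (lin_rem t *m jac j') else quad_rem t.

(** One integration by parts as a pure identity, with v = [ph j], w = [ph j.+1], rh = [rho j.+1], M
    = [jac j]. The products v w cancel, [M'] is the next [jac], and the coefficient of w^2 / 2 is
    the next [drift]. *)
Lemma nf_step (y rh bj S E ub r : 'rV[R]_n) (M : 'M[R]_n) (v w : R) :
  let M' := M *m A - A *m M + Phi bj in
  (y *m A + 2^-1 *: ((rh + w *: bj) *m Phi (rh + w *: bj)) + v *: ((rh + w *: bj) *m M)
     + S + ub + E)
  - (v *: (rh *m M) + w *: ((rh *m A + w *: (bj *m A) + r) *m M)) - (w * v) *: (bj *m M)
  = (y - w *: (rh *m M) - (w ^+ 2 / 2) *: (bj *m M)) *m A + 2^-1 *: (rh *m Phi rh)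
     + w *: (rh *m M') + (S + (w ^+ 2 / 2) *: (bj *m M' - bj *m A *m M))
     + ub + (E - w *: (r *m M)).
Proof.
move=> M'; rewrite /M'.
have E1 : (rh + w *: bj) *m Phi (rh + w *: bj) =
    rh *m Phi rh + (2 * w) *: (rh *m Phi bj) + w ^+ 2 *: (bj *m Phi bj).
  have E0 z : (rh + w *: bj) *m Phi z = rh *m Phi z + w *: (bj *m Phi z).
    by rewrite mulmxDl -scalemxAl.
  rewrite E0 (Phi_sym rh) (Phi_sym bj (rh + _)) !E0 (Phi_sym bj rh).
  set c1 := rh *m Phi rh; set c2 := rh *m Phi bj; set c3 := bj *m Phi bj.
  by apply/rowP => i; rewrite !mxE; ring.
rewrite {}E1 !(mulmxDl, mulmxDr, mulmxBr, mulmxBl, mulNmx, mulmxN) -!scalemxAl !mulmxA.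
set a1 := y *m A; set a2 := rh *m Phi rh; set a3 := rh *m Phi bj.
set a4 := bj *m Phi bj; set a5 := rh *m M; set a6 := bj *m M.
set a7 := rh *m A *m M; set a8 := bj *m A *m M; set a9 := r *m M.
set a10 := rh *m M *m A; set a11 := bj *m M *m A.
by apply/rowP => i; rewrite !mxE; field.
Qed.

Lemma nf_deriv j : has_vderiv T (nf j) (fun t =>
  nf j t *m A + 2^-1 *: (rho j t *m Phi (rho j t)) + ph j t *: (rho j t *m jac j)
  + \sum_(i < j.+1) (ph i t ^+ 2 / 2) *: drift i + ph 0%N t *: b + nf_rem j t).
Proof.
elim: j => [|j IH].
  apply: has_vderiv_ext dx => t _.
  rewrite /= big_ord1 /= /quad_rem /lin_rem /quad.
  set a1 := x t *m A; set a2 := x t *m Phi _; set a3 := x t *m H.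
  by apply/rowP => i; rewrite !mxE; ring.
have d1 := has_vderiv_scale (dph j) (has_vderiv_mulmx (jac j) (rho_deriv j.+1)).
have d2 : has_deriv T (fun t => ph j.+1 t ^+ 2 / 2) (fun t => ph j.+1 t * ph j t).
  apply: has_deriv_congr (has_derivZ 2^-1 (has_derivM (dph j) (dph j))) => t /=.
    by rewrite expr2 mulrC.
  by field.
have d3 := has_vderiv_scalel (kal j *m jac j) d2.
apply: has_vderiv_ext (has_vderivB (has_vderivB IH d1) d3) => t _ /=.
rewrite [in RHS]big_ord_recr /=.
have E : rho j t = (rho j t - ph j.+1 t *: kal j) + ph j.+1 t *: kal j by rewrite subrK.
rewrite [in X in X - _ - _]E.
exact: nf_step.
Qed.

End along.
End quadratic_normal_form.

(** [rho k] is O(I T + U^2 T), and by Cauchy-Schwarz its square is O(T W T + U^3). Modulo $S_1$, the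
    equation of [nf k] contains, besides a linear term and the drift, only terms quadratic in
    [rho k], products of [rho k] and [ph k], and terms cubic in [U]. *)
Lemma drift_estimate {R : realType} {n : nat} (A H Pi : 'M[R]_n) (b q : 'rV[R]_n)
    (Phi : 'rV[R]_n -> 'M[R]_n) (k : nat) (Cf Cr : R) :
  (forall x y, x *m Phi y = y *m Phi x) ->
  (forall i, kal A b i *m Pi = 0) ->
  Pi *m A *m Pi = A *m Pi ->
  (forall i, (i < k)%N -> drift A H b q Phi i *m Pi = 0) ->
  0 <= Cf -> 0 <= Cr ->
  (forall c : nat -> R, forall i, (i < k)%N ->
     `|c i| <= Cf * `|\sum_(j < k) c j *: kal A b j|) ->
  exists2 C : R, 0 < C & forall (T U : R) (x D : R -> 'rV[R]_n)
    (ph : nat -> R -> R) (I W : R -> R),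
    0 < T -> C * T <= 1 -> 0 <= U -> U <= 1 ->
    has_vderiv T x D -> x 0 = 0 -> x T *m Pi = x T ->
    (forall j, has_deriv T (ph j.+1) (ph j)) -> (forall j, ph j.+1 0 = 0) ->
    (forall j t, 0 <= t <= T -> `|ph j t| <= U) ->
    has_deriv T I (fun t => `|ph k t|) -> I 0 = 0 ->
    has_deriv T W (fun t => ph k t ^+ 2) -> W 0 = 0 ->
    (forall t, 0 <= t <= T -> `|lin_rem A b x D ph t| <= Cr * U ^+ 2) ->
    (forall t, 0 <= t <= T -> `|quad_rem A H b q Phi x D ph t| <= Cr * U ^+ 3) ->
    `|x T - (W T / 2) *: (drift A H b q Phi k *m Pi)| <= C * (T * W T + U ^+ 3).
Proof.
move=> Phi_sym Pikal PiA Pidrift Cf0 Cr0 free.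
have [Cp Cp0 Cphi] := bilinear_norm_le Phi_sym.
set kl := kal A b; set dr := drift A H b q Phi; set jc := jac A H b Phi.
pose mJ := \sum_(j < k.+1) mx_l1 (jc j).
pose bK := \sum_(j < k.+1) `|kl j|.
have mJ0 : 0 <= mJ by apply: sumr_ge0 => j _; exact: mx_l1_ge0.
have bK0 : 0 <= bK by exact: sumr_ge0.
(* [K] dominates all the structural constants, hence is independent of [T]. *)
pose K := 1 + mx_l1 A + mx_l1 Pi + mx_l1 (A *m Pi) + Cp + mJ + bK + `|dr k *m Pi| + Cr + Cf.
have pA := mx_l1_ge0 A; have pP := mx_l1_ge0 Pi; have pAP := mx_l1_ge0 (A *m Pi).
have pd : 0 <= `|dr k *m Pi| by [].
have K1 : 1 <= K by rewrite /K; lra.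
have K0 : 0 <= K by lra.
have KA : mx_l1 A <= K by rewrite /K; lra.
have KP : mx_l1 Pi <= K by rewrite /K; lra.
have KAP : mx_l1 (A *m Pi) <= K by rewrite /K; lra.
have KCp : Cp <= K by rewrite /K; lra.
have KmJ : mJ <= K by rewrite /K; lra.
have KbK : bK <= K by rewrite /K; lra.
have Kd : `|dr k *m Pi| <= K by rewrite /K; lra.
have KCr : Cr <= K by rewrite /K; lra.
have KCf : Cf <= K by rewrite /K; lra.
have KJ j : (j < k.+1)%N -> mx_l1 (jc j) <= K.
  move=> jk; apply: le_trans KmJ; rewrite /mJ (bigD1 (Ordinal jk))//= lerDl.
  by apply: sumr_ge0 => ? _; exact: mx_l1_ge0.
have Kb j : (j < k.+1)%N -> `|kl j| <= K.
  by move=> jk; apply: le_trans KbK;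
    rewrite /bK (bigD1 (Ordinal jk))//= lerDl sumr_ge0.
have mulK (x : 'rV[R]_n) (M : 'M[R]_n) c : mx_l1 M <= K -> `|x| <= c ->
  `|x *m M| <= K * c.
  by move=> MK xc; apply: le_trans (mulmx_norm_le _ _) _; apply: ler_pM => //;
    exact: mx_l1_ge0.
clearbody K mJ bK.
pose k' : R := k%:R; have k0 : 0 <= k' by exact: ler0n.
(* With Q = T W T + U^3 and [Rb] the bound on [rho k]: [c1] and [c2] compare Rb^2 and Rb I(T) with
   Q, [cE] bounds the remainder of the normal form, [c3] the integrated source terms, [c4] the
   distance from the normal form to the drift. [cP] and [cR] bound the primitives and the [rho j] at
   the final time by [Rb], and [c5] bounds the boundary terms. *)
pose c1 := 8 * K ^+ 2.
pose c2 := 4 * K.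
pose cE := K + k' * K ^+ 2.
pose c3 := K * (K * c1 + K * c2 + cE).
pose c4 := 2 * c3 + 2 * K ^+ 2.
pose cP := 2 * K ^+ 2.
pose cR := 1 + 2 * k' * cP * K.
pose c5 := k' * (K * (cP * cR * K + cP ^+ 2 * K ^+ 2)) * c1.
have K20 : 0 <= K ^+ 2 by exact: sqr_ge0.
have c10 : 0 <= c1 by rewrite mulr_ge0 ?sqr_ge0.
have c20 : 0 <= c2 by rewrite mulr_ge0.
have cE0 : 0 <= cE by rewrite addr_ge0// mulr_ge0 ?sqr_ge0.
have c30 : 0 <= c3 by do ?[apply: addr_ge0|apply: mulr_ge0] => //.
have c40 : 0 <= c4 by do ?[apply: addr_ge0|apply: mulr_ge0] => //.
have cP0 : 0 <= cP by rewrite mulr_ge0 ?sqr_ge0.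
have cR0 : 0 <= cR by do ?[apply: addr_ge0|apply: mulr_ge0] => //.
have cP20 : 0 <= cP ^+ 2 by exact: sqr_ge0.
have c50 : 0 <= c5 by do ?[apply: addr_ge0|apply: mulr_ge0] => //.
(* The summand 2 K yields K T <= 1/2, as [gronwall_small] requires. *)
exists (2 * K + c4 + c5); first by lra.
move=> T U x D ph I W T0 CT U0 U1 dx x0 xPi dph ph0 phU dI I0 dW W0 rU eU.
have KT : K * T <= 2^-1.
  have := mulr_ge0 (addr_ge0 c40 c50) (ltW T0).
  by move: CT; rewrite !mulrDl; lra.
have T1 : T <= 1 by have := ler_wpM2r (ltW T0) K1; lra.
have TT : 0 <= T <= T by rewrite lexx ltW.
have WT0 : 0 <= W T.
  by rewrite -W0; apply: (has_deriv_ge0 dW) TT => t _; exact: sqr_ge0.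
have IT0 : 0 <= I T by rewrite -I0; exact: (has_deriv_ge0 dI) TT.
have U30 : 0 <= U ^+ 3 by rewrite exprn_ge0.
have U40 : U ^+ 4 <= U ^+ 3 by rewrite exprS ler_piMl.
pose Q := T * W T + U ^+ 3.
have Q0 : 0 <= Q by exact: addr_ge0 (mulr_ge0 (ltW T0) WT0) U30.
have TW0 : 0 <= T * W T by exact: mulr_ge0 (ltW T0) WT0.
have U20 : 0 <= U ^+ 2 by exact: sqr_ge0.
have ITW : I T ^+ 2 <= T * W T.
  apply: cauchy_schwarz_primitive dI _ I0 W0 => //.
  by apply: has_deriv_ext dW => t _; rewrite real_normK ?num_real.
have T2 : T ^+ 2 <= 1 by rewrite expr2 mulr_ile1 ?(ltW T0).
have TU2 : (U ^+ 2 * T) ^+ 2 <= U ^+ 3.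
  rewrite exprMn -exprM; apply: le_trans U40.
  by rewrite ler_piMr ?exprn_ge0.
pose Rb := 2 * (K * I T + K * (U ^+ 2) * T).
have Tp := ltW T0.
have Rb0 : 0 <= Rb by do ?[apply: addr_ge0|apply: mulr_ge0] => //.
have Rb20 : 0 <= Rb ^+ 2 by exact: sqr_ge0.
have RbQ : Rb ^+ 2 <= c1 * Q.
  have -> : Rb ^+ 2 = 4 * K ^+ 2 * (I T + U ^+ 2 * T) ^+ 2 by rewrite /Rb; ring.
  have -> : c1 * Q = 4 * K ^+ 2 * (2 * Q) by rewrite /c1; ring.
  rewrite ler_wpM2l ?mulr_ge0 ?sqr_ge0//.
  have := sqr_ge0 (I T - U ^+ 2 * T); move: ITW TU2.
  by rewrite /Q; set V := U ^+ 2 * T; lra.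
have RbI : Rb * I T <= c2 * Q.
  have -> : Rb * I T = 2 * K * (I T ^+ 2 + U ^+ 2 * T * I T) by rewrite /Rb; ring.
  have -> : c2 * Q = 2 * K * (2 * Q) by rewrite /c2; ring.
  rewrite ler_wpM2l ?mulr_ge0//.
  have := sqr_ge0 (I T - U ^+ 2 * T); move: ITW TU2.
  by rewrite /Q; set V := U ^+ 2 * T; lra.
set rh := rho A b x ph.
have drh := @rho_deriv R n A b T x D ph dx dph.
have rh0 j : rh j 0 = 0.
  by elim: j => [|j IH]; rewrite /rh /= ?x0// -/rh -/(rh j) IH ph0 scale0r subr0.
have rhle t : 0 <= t <= T -> `|rh k t| <= Rb.
  have dG : has_deriv T (fun t => K * I t + K * (U ^+ 2) * t)
                        (fun t => K * `|ph k t| + K * (U ^+ 2) * 1).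
    by apply: has_derivD; apply: has_derivZ => //; exact: has_deriv_id.
  apply: (gronwall_small (ltW T0) K0 KT (drh k) (rh0 k) dG).
  - by rewrite I0 !mulr0 addr0.
  - by move=> s _; do ?[apply: addr_ge0|apply: mulr_ge0] => //.
  - move=> s sT; apply: le_trans (ler_normD _ _) _; rewrite addrA mulr1.
    apply: lerD; last by rewrite (le_trans (rU s sT))// ler_wpM2r ?sqr_ge0.
    apply: le_trans (ler_normD _ _) _; apply: lerD; first exact: mulK.
    by rewrite normrZ mulrC ler_wpM2r ?Kb.
set er := nf_rem A H b q Phi x D ph.
have erle j t : (j <= k)%N -> 0 <= t <= T ->
  `|er j t| <= (K + j%:R * K ^+ 2) * U ^+ 3.
  move=> + tT; elim: j => [_|j IH jk].
    by rewrite mul0r addr0 (le_trans (eU t tT))// ler_wpM2r.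
  rewrite /er /= -/er -/(er j); apply: le_trans (ler_normB _ _) _.
  have -> : (K + j.+1%:R * K ^+ 2) * U ^+ 3 =
    (K + j%:R * K ^+ 2) * U ^+ 3 + U * (K * (K * U ^+ 2)) by rewrite -natr1; ring.
  apply: lerD; first by apply: IH; exact: ltnW.
  rewrite normrZ; apply: ler_pM => //; first exact: phU.
  apply: (mulK); first by apply: KJ; exact: ltnW.
  by rewrite (le_trans (rU t tT))// ler_wpM2r ?sqr_ge0.
set y := nf A H b Phi x ph.
have dy := @nf_deriv R n A H b q Phi Phi_sym T x D ph dx dph k.
have y0 j : y j 0 = 0.
  elim: j => [|j IH]; rewrite /y /= ?x0// -/y -/(y j) IH ph0 !scale0r.
  by rewrite expr0n mul0r scale0r !subr0.
pose qt t := (2^-1 *: (rh k t *m Phi (rh k t)) + ph k t *: (rh k t *m jc k) + er k t) *m Pi.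
(* [Pi] kills the control term and the drifts of index below [k]; as its kernel is stable under [A],
   the projected equation is closed. *)
have dY : has_vderiv T (fun t => y k t *m Pi)
  (fun t => y k t *m Pi *m (A *m Pi) + qt t + (ph k t ^+ 2 / 2) *: (dr k *m Pi)).
  apply: has_vderiv_ext (has_vderiv_mulmx Pi dy) => t _.
  rewrite big_ord_recr /= !mulmxDl mulmx_suml big1 => [|i _]; last first.
    by rewrite -scalemxAl Pidrift// scaler0.
  rewrite add0r -!scalemxAl (Pikal 0%N : b *m Pi = 0) scaler0 addr0.
  rewrite mulmxA -(mulmxA _ Pi A) -(mulmxA _ (Pi *m A)) PiA mulmxA -/y -/rh -/er -/jc -/dr.
  rewrite /qt !mulmxDl -!scalemxAl.
  rewrite -!addrA; do 3!congr (_ + _); exact: addrC.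
pose g1 t := K * (2^-1 * (K * Rb ^+ 2) + K * Rb * `|ph k t| + cE * U ^+ 3).
pose G1 t := K * (2^-1 * (K * Rb ^+ 2) * t + K * Rb * I t + cE * U ^+ 3 * t).
have dG1 : has_deriv T G1 g1.
  apply: has_derivZ; apply: has_derivD.
    apply: has_derivD; last exact: has_derivZ.
    by apply: has_deriv_congr (has_derivZ _ (@has_deriv_id _ T)) => // t;
      rewrite mulr1.
  by apply: has_deriv_congr (has_derivZ _ (@has_deriv_id _ T)) => // t; rewrite mulr1.
have G10 : G1 0 = 0 by rewrite /G1 I0 !mulr0 !addr0 mulr0.
have g10 t : 0 <= g1 t.
  by do ?[apply: addr_ge0|apply: mulr_ge0] => //; rewrite invr_ge0.
have ph20 t : 0 <= ph k t ^+ 2 / 2 by rewrite mulr_ge0 ?sqr_ge0 ?invr_ge0.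
have qle t : 0 <= t <= T -> `|qt t| <= g1 t.
  move=> tT; apply: (mulK) => //.
  apply: le_trans (ler_normD _ _) _; apply: lerD; last first.
    exact: le_trans (erle k t (leqnn _) tT) _.
  apply: le_trans (ler_normD _ _) _; apply: lerD.
    rewrite normrZ ger0_norm ?invr_ge0// ler_wpM2l ?invr_ge0//.
    apply: le_trans (Cphi _ _) _; rewrite -mulrA expr2.
    by apply: ler_pM; rewrite ?mulr_ge0//; apply: ler_pM => //; exact: rhle.
  rewrite normrZ mulrC ler_wpM2r//; apply: (mulK); first exact: KJ.
  exact: rhle.
have G1Q : G1 T <= c3 * Q.
  rewrite /G1 /c3 -[leRHS]mulrA ler_wpM2l//.
  have -> : (K * c1 + K * c2 + cE) * Q = K * c1 * Q + K * c2 * Q + cE * Q by ring.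
  apply: lerD.
    apply: lerD.
      apply: (@le_trans _ _ (K * Rb ^+ 2)); last by rewrite -[leRHS]mulrA ler_wpM2l.
      have h : 0 <= K * Rb ^+ 2 by rewrite mulr_ge0 ?sqr_ge0.
      by have := ler_wpM2l h T1; lra.
    have -> : K * c2 * Q = K * (c2 * Q) by rewrite mulrA.
    by rewrite -mulrA; apply: ler_wpM2l.
  rewrite -[leLHS]mulrA; apply: ler_wpM2l => //.
  apply: (@le_trans _ _ (U ^+ 3)); last by rewrite /Q lerDr.
  by rewrite ler_piMr.
have dWh : has_deriv T (fun t => 2^-1 * W t) (fun t => ph k t ^+ 2 / 2).
  by apply: has_deriv_congr (has_derivZ 2^-1 dW) => // t; rewrite mulrC.
have Yle t : 0 <= t <= T -> `|y k t *m Pi| <= 2 * (G1 T + K * (2^-1 * W T)).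
  move=> tT.
  apply: (gronwall_small (G := fun t => G1 t + K * (2^-1 * W t))
    (g := fun t => g1 t + K * (ph k t ^+ 2 / 2)) (ltW T0) K0 KT dY) tT.
  - by rewrite y0 mul0mx.
  - by apply: has_derivD => //; exact: has_derivZ.
  - by rewrite G10 W0 !mulr0 addr0.
  - by move=> s _; apply: addr_ge0 => //; exact: mulr_ge0.
  - move=> s sT; apply: le_trans (ler_normD _ _) _; rewrite addrA; apply: lerD.
      apply: le_trans (ler_normD _ _) _; apply: lerD; last exact: qle.
      exact: mulK.
    by rewrite normrZ (ger0_norm (ph20 s)) mulrC ler_wpM2r.
pose B := 2 * (G1 T + K * (2^-1 * W T)).
(* [Yle] contains W(T) without a small factor; put into the linear term and integrated once more, it
   gains the factor [T]. *)
have main : `|y k T *m Pi - (2^-1 * W T) *: (dr k *m Pi)| <= c4 * Q.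
  have dZ := has_vderivB dY (has_vderiv_scalel (dr k *m Pi) dWh).
  have dGB : has_deriv T (fun t => K * B * t + G1 t) (fun t => K * B * 1 + g1 t).
    by apply: has_derivD => //; apply: has_derivZ; exact: has_deriv_id.
  have := has_vderiv_norm (ltW T0) dZ dGB _ TT.
  rewrite y0 mul0mx W0 mulr0 scale0r subrr subr0 mulr0 G10 addr0 subr0 => h.
  apply: le_trans (h _) _.
    move=> t tT; rewrite addrK; apply: le_trans (ler_normD _ _) _.
    apply: lerD; last exact: qle.
    by rewrite mulr1; apply: (mulK) => //; exact: Yle.
  have B0 : 0 <= B.
    apply: mulr_ge0 => //; apply: addr_ge0; last by rewrite !mulr_ge0 ?invr_ge0.
    by rewrite -G10; apply: (has_deriv_ge0 dG1) TT => t _; exact: g10.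
  have G1p : 0 <= G1 T by rewrite -G10; apply: (has_deriv_ge0 dG1) TT => t _;
    exact: g10.
  have -> : K * B * T + G1 T = 2 * (K * T) * G1 T + K ^+ 2 * (T * W T) + G1 T.
    by rewrite /B; field.
  have h1 : 2 * (K * T) * G1 T <= G1 T by rewrite ler_piMl//; lra.
  have h2 : K ^+ 2 * (T * W T) <= K ^+ 2 * Q by rewrite ler_wpM2l ?sqr_ge0// /Q lerDl.
  have h3 : 0 <= K ^+ 2 * Q by rewrite mulr_ge0 ?sqr_ge0.
  by rewrite /c4; move: h1 h2 h3 G1Q; lra.
have rhE j t : rh j t = x t - \sum_(i < j) ph i.+1 t *: kl i.
  elim: j => [|j IH]; first by rewrite big_ord0 subr0.
  by rewrite /rh /= -/rh -/(rh j) IH big_ord_recr /= opprD addrA.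
(* The sum of the ph_(i+1)(T) b_i equals rho_k(T) Pi - rho_k(T), because x(T) is fixed by [Pi];
   [free] extracts each coefficient. *)
have phT j : (j < k)%N -> `|ph j.+1 T| <= cP * Rb.
  move=> jk; apply: le_trans (free (fun j => ph j.+1 T) j jk) _.
  have -> : \sum_(j < k) ph j.+1 T *: kl j = rh k T *m Pi - rh k T.
    have E := rhE k T.
    have S0 : (\sum_(i < k) ph i.+1 T *: kl i) *m Pi = 0.
      by rewrite mulmx_suml big1// => i _; rewrite -scalemxAl Pikal scaler0.
    by rewrite E mulmxBl S0 xPi subr0 opprB addrC subrK.
  have -> : cP * Rb = K * (2 * (K * Rb)) by rewrite /cP; ring.
  apply: ler_pM => //; apply: le_trans (ler_normB _ _) _.
  have h1 := mulK _ _ _ KP (rhle _ TT).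
  have h2 : Rb <= K * Rb by rewrite ler_peMl.
  by have := rhle _ TT; move: h1 h2; lra.
have sumle j : (j <= k)%N -> `|\sum_(i < j) ph i.+1 T *: kl i| <= k' * cP * K * Rb.
  move=> jk; apply: le_trans (ler_norm_sum _ _ _) _.
  apply: (@le_trans _ _ (\sum_(i < j) (cP * Rb * K))).
    apply: ler_sum => i _; rewrite normrZ; have ik := leq_trans (ltn_ord i) jk.
    by apply: ler_pM => //; [exact: phT|apply: Kb; exact: leqW].
  rewrite sumr_const card_ord -mulr_natl.
  have -> : k' * cP * K * Rb = k' * (cP * Rb * K) by ring.
  apply: ler_wpM2r; last by rewrite /k' ler_nat.
  exact: mulr_ge0 (mulr_ge0 cP0 Rb0) K0.
have rhT j : (j <= k)%N -> `|rh j T| <= cR * Rb.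
  move=> jk.
  have -> : rh j T = rh k T + \sum_(i < k) ph i.+1 T *: kl i - \sum_(i < j) ph i.+1 T *: kl i.
    by rewrite !rhE subrK.
  apply: le_trans (ler_normB _ _) _.
  have h := ler_normD (rh k T) (\sum_(i < k) ph i.+1 T *: kl i).
  have := sumle _ (leqnn k); have := sumle _ jk; have := rhle _ TT; move: h.
  by rewrite /cR; lra.
(* Every boundary term is a product of two factors of order [Rb]. *)
have bd j : (j <= k)%N ->
    `|x T *m Pi - y j T *m Pi| <= j%:R * (K * (cP * cR * K + cP ^+ 2 * K ^+ 2)) * Rb ^+ 2.
  elim: j => [_|j IH jk]; first by rewrite /y /= subrr normr0 !mul0r.
  rewrite /y /= -/y -/(y j) -/(rh j) -/kl -/jc.
  set z1 := ph j.+1 T *: _; set z2 := (_ / 2) *: _.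
  have -> : x T *m Pi - (y j T - z1 - z2) *m Pi = (x T *m Pi - y j T *m Pi) + (z1 + z2) *m Pi.
    rewrite !mulmxBl mulmxDl; set a1 := x T *m Pi; set a2 := y j T *m Pi.
    set a3 := z1 *m Pi; set a4 := z2 *m Pi.
    by apply/rowP => i; rewrite !mxE; ring.
  apply: le_trans (ler_normD _ _) _; rewrite -natr1 mulrDl mul1r mulrDl.
  apply: lerD; first by apply: IH; exact: ltnW.
  rewrite -mulrA; apply: (mulK) => //.
  apply: le_trans (ler_normD _ _) _; rewrite mulrDl.
  have Jj := KJ j (ltnW jk : (j < k.+1)%N).
  have pj := phT j jk.
  apply: lerD.
    have -> : cP * cR * K * Rb ^+ 2 = cP * Rb * (K * (cR * Rb)) by ring.
    rewrite normrZ; apply: ler_pM => //; apply: (mulK) => //.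
    exact: (rhT j.+1 jk).
  have -> : cP ^+ 2 * K ^+ 2 * Rb ^+ 2 = (cP * Rb) ^+ 2 * (K * K) by ring.
  rewrite normrZ; apply: ler_pM => //; last by apply: (mulK) => //; exact/Kb/ltnW.
  have s0 : 0 <= ph j.+1 T ^+ 2 / 2 by rewrite divr_ge0 ?sqr_ge0.
  rewrite (ger0_norm s0).
  have : `|ph j.+1 T| ^+ 2 <= (cP * Rb) ^+ 2.
    by rewrite !expr2; apply: ler_pM.
  have := sqr_ge0 (ph j.+1 T).
  by rewrite real_normK ?num_real//; lra.
have -> : x T - (W T / 2) *: (dr k *m Pi) =
    (x T *m Pi - y k T *m Pi) + (y k T *m Pi - (2^-1 * W T) *: (dr k *m Pi)).
  by rewrite addrA subrK xPi mulrC.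
apply: le_trans (ler_normD _ _) _; rewrite -/Q.
have h5 : `|x T *m Pi - y k T *m Pi| <= c5 * Q.
  apply: le_trans (bd k (leqnn k)) _; rewrite /c5 -[leRHS]mulrA.
  by apply: ler_wpM2l => //; do ?[apply: addr_ge0|apply: mulr_ge0] => //.
have KQ : 0 <= K * Q by exact: mulr_ge0.
by move: main h5; lra.
Qed.

(** * Small controls produce a drift *)

Section controls.
Context {R : realType}.
Implicit Types (T : R) (u g : R -> R).

Lemma itvoo_le T t : 0 < t < T -> 0 <= t <= T.
Proof. by case/andP => t0 tT; rewrite (ltW t0) (ltW tT). Qed.

Lemma within_le_closure T (c : R) g : 0 < T -> {within `[0, T], continuous g} ->
  (forall t, 0 < t < T -> g t <= c) -> forall t, 0 <= t <= T -> g t <= c.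
Proof.
move=> T0 cg gc t tT; apply/ler_addgt0Pr => e e0.
have cc : continuous (fun t => g (Num.max 0 (Num.min T t))) :=
  clamp_continuous (ltW T0) cg.
have /cvgrPdist_lt/(_ e e0) [d /= d0 dP] := cc t.
pose th := Num.min 2^-1 (d / T).
have th0 : 0 < th by rewrite lt_min invr_gt0 ltr0n divr_gt0.
have th1 : th <= 2^-1 by rewrite ge_min lexx.
have thd : th * T <= d by rewrite -ler_pdivlMr// ge_min lexx orbT.
have thT : 0 < th * T by rewrite mulr_gt0.
(* Moving towards the midpoint enters the open interval even from an end point. *)
pose s := t + th * (T / 2 - t).
have tht : 0 <= th * t by rewrite mulr_ge0 ?(ltW th0)//; case/andP: tT.
have tht2 : th * t <= 2^-1 * t by rewrite ler_wpM2r//; case/andP: tT.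
have tht3 : th * t <= th * T by rewrite ler_wpM2l ?(ltW th0)//; case/andP: tT.
have thT4 : th * (T - t) <= 2^-1 * (T - t).
  by rewrite ler_wpM2r// subr_ge0; case/andP: tT.
have sE : s = t + th * T / 2 - th * t by rewrite /s; ring.
have sT : 0 < s < T.
  by rewrite sE; move: thT4; rewrite !mulrBr => ?; case/andP: tT => *; lra.
have /dP : `|t - s| < d by rewrite sE ltr_norml; lra.
rewrite (clampE tT) (clampE (itvoo_le sT)).
by move=> /ltr_normlW; have := gc s sT; lra.
Qed.

(** [sup] is an upper bound only for a bounded set; boundedness comes from the continuous extensions
    in [Cm_itv]. *)
Lemma Cm_norm_bound (m : nat) T eta u : 0 < T -> Cm_itv m 0 T u ->
  Cm_norm m 0 T u <= eta ->
  forall j, (j <= m)%N -> forall t, 0 < t < T -> `|u^`(j) t| <= eta.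
Proof.
move=> T0 [cu du gu] nu j jm t tT; apply: le_trans nu.
have jm' : (j < m.+1)%N by [].
apply: le_trans (_ : sup [set `|u^`(j) t| | t in `]0, T[] <= _); last first.
  exact: (le_bigmax _ (fun j : 'I_m.+1 => sup [set `|u^`(j) t| | t in `]0, T[]) (Ordinal jm')).
apply: sup_upper_bound; last by exists t => //=; rewrite in_itv.
split; first by exists `|u^`(j) t|, t => //=; rewrite in_itv.
have [g [cg ug]] := gu j jm.
have cgn : {within `[0, T], continuous (fun t => `|g t|)}.
  by move=> s; apply: cvg_norm; exact: cg.
have [c _ gc] := EVT_max (ltW T0) cgn.
exists `|g c| => _ [s /= sT <-].
by have := gc s (subset_itv_oo_cc sT); rewrite -(ug s (mem_set sT)).
Qed.

Lemma exists_primitives T u : 0 <= T -> {within `[0, T], continuous u} ->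
  exists ph : nat -> R -> R, [/\ ph 0%N = u, forall j, has_deriv T (ph j.+1) (ph j) &
    forall j, ph j.+1 0 = 0].
Proof.
move=> T0 cu.
have /choice[P HP] : forall g : R -> R, exists G, {within `[0, T], continuous g} ->
    has_deriv T G g /\ G 0 = 0.
  move=> g; have [cg|ncg] := pselect {within `[0, T], continuous g}; last by exists g.
  by have [G [G0 dG _]] := within_primitive T0 cg; exists G.
pose ph j := iter j P u.
have cph j : {within `[0, T], continuous (ph j)}.
  elim: j => [//|j IH]; have [dG _] := HP _ IH.
  exact: has_deriv_within dG.
by exists ph; split=> // j; have [] := HP _ (cph j).
Qed.

(** [X] coincides with [x] on the interval and, being built from primitives, is differentiable at
    both ends too. *)
Lemma trajectory_deriv {n : nat} (f : 'rV[R]_n * R -> 'rV[R]_n) T xs x u :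
  0 <= T -> continuous f -> {within `[0, T], continuous u} ->
  trajectory f T xs x u ->
  exists X, [/\ has_vderiv T X (fun t => f (X t, u t)), X 0 = xs & X T = x T].
Proof.
move=> T0 cf cu [cx _ xE].
have cfi i : {within `[0, T], continuous (fun s => f (x s, u s) 0 i)}.
  move=> s.
  apply: (@continuous_comp (subspace `[0, T]) _ _ (fun s => f (x s, u s)) (fun M => M 0 i) s).
    apply: (@continuous_comp (subspace `[0, T]) _ _ (fun s => (x s, u s)) f s);
      last exact: cf.
    exact: (cvg_pair (cx s) (cu s)).
  exact: coord_continuous.
have /choice[G HG] : forall i, exists G, [/\ G 0 = 0,
    has_deriv T G (fun s => f (x s, u s) 0 i) &
    forall t, 0 <= t <= T ->
      \int[@lebesgue_measure R]_(s in `[0, t]) (f (x s, u s) 0 i) = G t].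
  by move=> i; exact: within_primitive T0 (cfi i).
pose X t : 'rV[R]_n := \row_i (xs 0 i + G i t).
have XE t : 0 <= t <= T -> X t = x t.
  move=> tT; apply/rowP => i; rewrite mxE; have [_ _ <-//] := HG i.
  by rewrite -xE// inE /= in_itv.
exists X; split; last by rewrite XE// lexx T0.
  move=> i; have [_ dG _] := HG i.
  apply: (has_deriv_congr (F := fun t => xs 0 i + G i t)
    (f := fun t => 0 + f (X t, u t) 0 i)) => [t|t|].
  - by rewrite mxE.
  - by rewrite add0r.
  apply: has_derivD; first exact: has_deriv_cst.
  by apply: has_deriv_ext dG => t tT; rewrite XE.
by apply/rowP => i; rewrite mxE; have [-> _ _] := HG i; rewrite addr0.
Qed.

End controls.

(** Steering 0 to - tau d puts the final state at distance (tau + W(T) / 2) |d| from (W(T) / 2) d,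
    whereas [drift_estimate] allows at most |d| W(T) / 8. *)
Lemma stlc_drift_zero {R : realType} {n : nat} (f : 'rV[R]_n * R -> 'rV[R]_n)
    (A H Pi : 'M[R]_n) (b q : 'rV[R]_n) (Phi : 'rV[R]_n -> 'M[R]_n)
    (k : nat) (Cf Cq r : R) :
  continuous f -> smoothly_STLC f ->
  0 < r -> 0 <= Cq ->
  (forall c (x : 'rV[R]_n) u, c <= r -> `|x| <= c -> `|u| <= c ->
    `|f (x, u) - x *m A - u *: b| <= Cq * c ^+ 2 /\
    `|f (x, u) - x *m A - u *: b - quad H q Phi x u| <= Cq * c ^+ 3) ->
  (forall x y, x *m Phi y = y *m Phi x) ->
  (forall i, kal A b i *m Pi = 0) ->
  Pi *m A *m Pi = A *m Pi -> Pi *m Pi = Pi ->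
  (forall i, (i < k)%N -> drift A H b q Phi i *m Pi = 0) ->
  0 <= Cf ->
  (forall c : nat -> R, forall i, (i < k)%N ->
     `|c i| <= Cf * `|\sum_(j < k) c j *: kal A b j|) ->
  drift A H b q Phi k *m Pi = 0.
Proof.
move=> cf hc r0 Cq0 taylor Phi_sym Pikal PiA PiPi Pidrift Cf0 free.
set d := drift A H b q Phi k *m Pi.
apply/eqP; apply/negPn/negP => dn0.
have D0 : 0 < `|d| by rewrite normr_gt0.
have [C C0 est] := drift_estimate Phi_sym Pikal PiA Pidrift Cf0 Cq0 free.
pose K := mx_l1 A + `|b| + Cq.
have K0 : 0 <= K by rewrite !addr_ge0// mx_l1_ge0.
(* Each summand encodes one smallness condition: T, C T and K T at most 1/2, and C T <= |d| / 16. *)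
pose E := 2 * (1 + C + K + 8 * C / `|d|).
have p1 : 0 <= 8 * C / `|d| by rewrite divr_ge0 ?mulr_ge0 ?(ltW C0).
have E0 : 0 < E by rewrite /E; lra.
pose T := E^-1.
have T0 : 0 < T by rewrite invr_gt0.
have TE a : 2 * a <= E -> a * T <= 2^-1.
  by move=> aE; rewrite ler_pdivrMr//; lra.
have T1 : T <= 1 by have := TE 1 _; rewrite mul1r => /(_ _); rewrite /E; lra.
have CT : C * T <= 2^-1 by apply: TE; rewrite /E; lra.
have KT : K * T <= 2^-1 by apply: TE; rewrite /E; lra.
have CDT : C * T <= `|d| / 16.
  have : 8 * C / `|d| * T <= 2^-1 by apply: TE; rewrite /E; lra.
  rewrite mulrAC ler_pdivrMr// mulrAC; lra.
have eps0 : 0 < `|d| / (16 * C) by rewrite divr_gt0// mulr_gt0.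
have [eta0 eta00 interp] := interpolation k T0 T1 eps0.
pose eta := Num.min eta0 (Num.min (r / 2) 2^-1).
have eta_gt0 : 0 < eta by rewrite !lt_min eta00 divr_gt0// invr_gt0 ltr0n.
have etae : eta <= eta0 by rewrite ge_min lexx.
have etar : eta <= r / 2 by rewrite !ge_min lexx orbT.
have eta1 : eta <= 2^-1 by rewrite !ge_min lexx !orbT.
(* [interpolation] uses 3 k + 2 derivatives of [ph k]; the [k]-th one is [u], which leaves 2 k + 2
   for [u]. *)
have [delta delta0 ctrl] := hc (2 * k + 2)%N T eta T0 eta_gt0.
pose tau := delta / `|d|.
have tau0 : 0 < tau by exact: divr_gt0.
have tauD : `|0 : 'rV[R]_n| + `|- tau *: d| <= delta.
  by rewrite normr0 add0r normrZ normrN (gtr0_norm tau0) divfK// gt_eqF.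
have [x [u [trx Cu nu x0 xT]]] := ctrl 0 (- tau *: d) tauD.
have cu : {within `[0, T], continuous u} by case: Cu.
have [X [dX X0 XT]] := trajectory_deriv (ltW T0) cf cu trx.
have [ph [phu dph ph0]] := exists_primitives (ltW T0) cu.
have TT : 0 <= T <= T by rewrite lexx ltW.
have ub j t : (j <= 2 * k + 2)%N -> 0 < t < T -> `|u^`(j) t| <= eta.
  by move=> jm; exact: Cm_norm_bound T0 Cu nu j jm t.
have cuN : {within `[0, T], continuous (fun t => `|u t|)}.
  by move=> s; apply: cvg_norm; exact: cu.
have prim_le c : 0 <= c -> (forall t, 0 <= t <= T -> `|u t| <= c) ->
    forall j t, 0 <= t <= T -> `|ph j t| <= c.
  move=> c0 uc; elim=> [|j IH] t tT; first by rewrite phu; exact: uc.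
  have dG : has_deriv T (fun t => c * t) (fun t => c * 1).
    by apply: has_derivZ; exact: has_deriv_id.
  have := has_deriv_norm (dph j) dG _ tT; rewrite ph0 mulr0 !subr0 => h.
  apply: le_trans (h _) _; first by move=> s sT; rewrite mulr1; exact: IH.
  by rewrite ler_piMr//; case/andP: tT => _ /le_trans; apply.
have cph j : {within `[0, T], continuous (ph j)}.
  by case: j => [|j]; [rewrite phu|exact: has_deriv_within (dph j)].
have [W [W0 dW _]] : exists W, [/\ W 0 = 0, has_deriv T W (fun t => ph k t ^+ 2) &
    forall t, 0 <= t <= T ->
      \int[@lebesgue_measure R]_(s in `[0, t]) (ph k s ^+ 2) = W t].
  apply: within_primitive; first exact: ltW.
  have -> : (fun t => ph k t ^+ 2) = (fun t => ph k t * ph k t).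
    by apply/funext => t; rewrite expr2.
  exact: within_continuousM.
have [I [I0 dI _]] : exists I, [/\ I 0 = 0, has_deriv T I (fun t => `|ph k t|) &
    forall t, 0 <= t <= T ->
      \int[@lebesgue_measure R]_(s in `[0, t]) `|ph k s| = I t].
  apply: within_primitive; first exact: ltW.
  by move=> s; apply: cvg_norm; exact: cph.
have WT0 : 0 <= W T.
  by rewrite -W0; apply: (has_deriv_ge0 dW) TT => t _; exact: sqr_ge0.
have ule t : 0 <= t <= T -> `|u t| <= eta.
  by apply: within_le_closure T0 cuN _ t => t tT; exact: (ub 0%N).
have phle := prim_le eta (ltW eta_gt0) ule.
(* The successive derivatives of the [k]-th primitive of [u]. *)
pose g j := if (j < k)%N then ph (k - j)%N else u^`(j - k).
have kN : (3 * k + 2 - k = 2 * k + 2)%N by rewrite mulSn -addnA addKn.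
have cubic t : 0 < t < T -> `|u t| ^+ 3 <= `|d| / (16 * C) * W T.
  have g0 : g 0%N = ph k.
    by rewrite /g subn0; case: ifP => //; case: (k) => //; rewrite phu.
  have gk : g k = u by rewrite /g ltnn subnn.
  rewrite -gk; apply: interp => //.
  - move=> j jN t' tT'; have tT'' : 0 <= t' <= T by exact: itvoo_le.
    rewrite /g; case: ltnP => jk.
      have -> : (k - j = (k - j.+1).+1)%N by rewrite subnSK.
      have := dph (k - j.+1)%N t' tT''; case: ltnP => // kj.
      by have -> : j.+1 = k by [apply/eqP; rewrite eqn_leq jk kj]; rewrite subnn phu.
    rewrite ltnNge (leqW jk) /= subSn// derive1nS derive1E.
    case: Cu => _ du _; apply/derivableP/du; last by rewrite inE /= in_itv.
    by rewrite -kN ltn_sub2r// (leq_ltn_trans jk).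
  - move=> j jN t' tT'; apply: le_trans etae.
    rewrite /g; case: ltnP => jk; last by apply: ub => //; rewrite -kN leq_sub2r.
    by apply: phle; exact: itvoo_le.
  - by rewrite g0.
  - by rewrite g0.
pose B := `|d| / (16 * C) * W T.
have B0 : 0 <= B by rewrite mulr_ge0// ltW.
pose U := Num.min eta (B `^ (3%:R^-1)).
have U0 : 0 <= U by rewrite le_min (ltW eta_gt0) powR_ge0.
have BE : (B `^ (3%:R^-1)) ^+ 3 = B.
  by rewrite -powR_mulrn ?powR_ge0// -powRrM mulVf ?powRr1.
have U3 : U ^+ 3 <= B.
  rewrite -[leRHS]BE; apply: lerXn2r; rewrite ?nnegrE ?powR_ge0//.
  by rewrite ge_min lexx orbT.
have Ue : U <= eta by rewrite ge_min lexx.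
have uU t : 0 <= t <= T -> `|u t| <= U.
  apply: within_le_closure T0 cuN _ t => t tT.
  rewrite le_min ule/=; last exact: itvoo_le.
  by rewrite -(@ler_pXn2r _ 3)// ?nnegrE ?powR_ge0// BE cubic.
have XU t : 0 <= t <= T -> `|X t| <= U.
  (* The cap 1 turns the quadratic Taylor remainder Cq c^2 into Cq c. *)
  apply: (apriori_bound (r := Num.min r 1) (ltW T0) K0 KT U0 _ dX X0).
    by rewrite lt_min; apply/andP; split; lra.
  move=> s c sT Uc; rewrite le_min => /andP[cr c1] Xc.
  have c0 : 0 <= c by exact: le_trans Uc.
  have uc : `|u s| <= c by rewrite (le_trans (uU s sT)).
  have [h _] := taylor c (X s) (u s) cr Xc uc.
  have -> : f (X s, u s) = (X s *m A + u s *: b) + (f (X s, u s) - X s *m A - u s *: b).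
    by apply/rowP => i; rewrite !mxE; ring.
  apply: le_trans (ler_normD _ _) _; rewrite /K mulrDl; apply: lerD.
    apply: le_trans (ler_normD _ _) _; rewrite mulrDl; apply: lerD.
      apply: le_trans (mulmx_norm_le _ _) _.
      by rewrite ler_wpM2l// mx_l1_ge0.
    by rewrite normrZ mulrC ler_wpM2l.
  by apply: le_trans h _; rewrite ler_wpM2l// expr2 ler_piMl.
have Ur : U <= r by lra.
have := est T U X (fun t => f (X t, u t)) ph I W T0 _ U0 _ dX X0 _ dph ph0
  (prim_le U U0 uU) dI I0 dW W0 _ _.
rewrite XT xT -/d => h.
have {}h : `|- tau *: d - (W T / 2) *: d| <= C * (T * W T + U ^+ 3).
  apply: h.
  - lra.
  - lra.
  - by rewrite -scalemxAl /d -mulmxA PiPi.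
  - move=> t tT; rewrite /lin_rem phu.
    by have [] := taylor U (X t) (u t) Ur (XU t tT) (uU t tT).
  - move=> t tT; rewrite /quad_rem /lin_rem phu.
    by have [] := taylor U (X t) (u t) Ur (XU t tT) (uU t tT).
move: h; rewrite -scalerBl normrZ -opprD normrN ger0_norm; last first.
  exact: addr_ge0 (ltW tau0) (divr_ge0 WT0 (ler0n _ 2)).
have e1 : C * T * W T <= `|d| / 16 * W T by rewrite ler_wpM2r.
have e2 : C * U ^+ 3 <= `|d| / 16 * W T.
  apply: le_trans (_ : C * B <= _); first by rewrite ler_wpM2l// ltW.
  rewrite le_eqVlt; apply/orP; left; apply/eqP; rewrite /B; field.
  by rewrite gt_eqF.
have e3 : 0 < tau * `|d| by rewrite mulr_gt0.
have e4 : 0 <= `|d| * W T by rewrite mulr_ge0.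
by move: e1 e2 e3 e4; lra.
Qed.

(** * Kalman vectors and the Jacobi identity *)

Section kalman_space.
Context {R : realType} {n : nat}.
Variables (A H : 'M[R]_n) (b q : 'rV[R]_n) (Phi : 'rV[R]_n -> 'M[R]_n).
Hypothesis Phi_sym : forall x y, x *m Phi y = y *m Phi x.
Local Notation kl := (kal A b).
Local Notation jc := (jac A H b Phi).
Local Notation dr := (drift A H b q Phi).

Definition kal_mx (k : nat) : 'M[R]_(k, n) := \matrix_(i < k) kl i.

Lemma kal_sub k i : (i < k)%N -> (kl i <= kal_mx k)%MS.
Proof. by move=> ik; apply: (eq_row_sub (Ordinal ik)); rewrite rowK. Qed.

Lemma kal_mx_sub m (k : nat) (S : 'M[R]_(m, n)) :
  (forall i, (i < k)%N -> (kl i <= S)%MS) -> (kal_mx k <= S)%MS.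
Proof. by move=> h; apply/row_subP => i; rewrite rowK; exact: h. Qed.

Lemma kal_mxA k : (kal_mx k *m A <= kal_mx k.+1)%MS.
Proof.
by apply/row_subP => i; rewrite row_mul rowK; exact: (@kal_sub k.+1 i.+1 (ltn_ord i)).
Qed.

Lemma kal_dependent k : (kl k <= kal_mx k)%MS ->
  forall j, (kl (k + j) <= kal_mx (k + j))%MS.
Proof.
move=> kk; elim=> [|j IH]; first by rewrite addn0.
rewrite addnS; apply: submx_trans (kal_mxA _).
exact: submxMr.
Qed.

(** In a nontrivial relation, the last vector with a nonzero coefficient is a combination of its
    predecessors. *)
Lemma kal_free k : (forall l, (l < k)%N -> ~ (kl l <= kal_mx l)%MS) ->
  row_free (kal_mx k).
Proof.
move=> h; apply: inj_row_free => v vB; apply/rowP => i; rewrite mxE.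
apply: contrapT => /eqP vi0.
pose P := [pred j | (v 0 j != 0)].
have Pi : P i by [].
case: (@arg_maxnP _ i P (fun j => nat_of_ord j) Pi) => l vl0 lmax.
apply: (h l (ltn_ord l)).
have E : v 0 l *: kl l = - \sum_(j < k | j != l) v 0 j *: kl j.
  have : \sum_j v 0 j *: kl j = 0.
    by rewrite -[RHS]vB mulmx_sum_row; apply: eq_bigr => j _; rewrite rowK.
  by rewrite (bigD1 l)//= => /eqP; rewrite addr_eq0 => /eqP.
have -> : kl l = (v 0 l)^-1 *: (v 0 l *: kl l) by rewrite scalerA mulVf ?scale1r.
rewrite E; apply: scalemx_sub; rewrite eqmx_opp; apply: summx_sub => j jl.
have [->|vj0] := eqVneq (v 0 j) 0; first by rewrite scale0r sub0mx.
apply: scalemx_sub; apply: kal_sub.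
by rewrite ltn_neqAle jl /=; exact: lmax.
Qed.

(** Among n + 1 vectors of an n-dimensional space one depends on its predecessors; their span is
    then stable under [A]. *)
Lemma kal_stable : exists m, forall i, (kl i <= kal_mx m)%MS.
Proof.
have [l lB] : exists l, (kl l <= kal_mx l)%MS.
  apply: contrapT => /forallNP h.
  have := @kal_free n.+1 (fun l _ => h l); rewrite /row_free => /eqP rk.
  by have := rank_leq_col (kal_mx n.+1); rewrite rk ltnn.
exists l.
have AS : (kal_mx l *m A <= kal_mx l)%MS.
  apply: submx_trans (kal_mxA l) _; apply: kal_mx_sub => j.
  by rewrite ltnS leq_eqVlt => /predU1P[->//|]; exact: kal_sub.
have main j : (kl (l + j) <= kal_mx l)%MS.
  elim: j => [|j IH]; first by rewrite addn0.
  by rewrite addnS; exact: submx_trans (submxMr _ IH) AS.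
move=> i; have [il|li] := ltnP i l; first exact: kal_sub.
by rewrite -(subnKC li).
Qed.

Lemma kal_free_bound k : row_free (kal_mx k) ->
  exists2 C : R, 0 <= C & forall c : nat -> R, forall i, (i < k)%N ->
    `|c i| <= C * `|\sum_(j < k) c j *: kl j|.
Proof.
move=> fB; pose P := pinvmx (kal_mx k).
exists (\sum_i \sum_j `|P i j|).
  by apply: sumr_ge0 => i _; exact: sumr_ge0.
move=> c i ik; pose v : 'rV[R]_k := \row_j c j.
have E : \sum_(j < k) c j *: kl j = v *m kal_mx k.
  by rewrite mulmx_sum_row; apply: eq_bigr => j _; rewrite mxE rowK.
have -> : c i = (v *m kal_mx k *m P) 0 (Ordinal ik) by rewrite mulmxKp// mxE.
rewrite E mxE; apply: le_trans (ler_norm_sum _ _ _) _.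
rewrite mulr_suml; apply: ler_sum => j _; rewrite normrM mulrC.
apply: ler_pM => //; last exact: rV_coord_le.
by rewrite (bigD1 (Ordinal ik))//= lerDl sumr_ge0.
Qed.

(** [Pi] is a projector with kernel [S], so the rows of Pi - 1 lie in [S]; those of (Pi - 1) A do as
    well, and [Pi] kills them. *)
Lemma stable_projector m (S : 'M[R]_(m, n)) : (S *m A <= S)%MS ->
  exists Pi : 'M[R]_n, [/\ forall v : 'rV_n, (v *m Pi == 0) = (v <= S)%MS,
    Pi *m A *m Pi = A *m Pi & Pi *m Pi = Pi].
Proof.
move=> AS; pose Pi := cokermx S *m pinvmx (cokermx S).
have coP : cokermx S *m pinvmx (cokermx S) *m cokermx S = cokermx S.
  by rewrite mulmxKpV.
have PiS (p : nat) (v : 'M[R]_(p, n)) : (v *m Pi == 0) = (v <= S)%MS.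
  rewrite submxE; apply/eqP/eqP => h.
    have -> : v *m cokermx S = v *m Pi *m cokermx S by rewrite -mulmxA coP.
    by rewrite h mul0mx.
  by rewrite mulmxA h mul0mx.
have PiPi : Pi *m Pi = Pi by rewrite {1}/Pi mulmxA coP.
exists Pi; split=> //.
have : ((Pi - 1%:M) *m A <= S)%MS.
  apply: submx_trans AS; apply: submxMr; rewrite -PiS.
  by rewrite mulmxBl mul1mx PiPi subrr.
by rewrite -PiS !mulmxBl mul1mx subr_eq0 => /eqP.
Qed.

(** Up to sign, the value at the origin of the bracket of the [i]-fold and [j]-fold brackets of [f1]
    with [f0]; [drift i.+1] is [beta i i.+1]. *)
Definition beta (i j : nat) : 'rV[R]_n := kl i *m jc j - kl j *m jc i.

Lemma betaC i j : beta j i = - beta i j.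
Proof. by rewrite /beta opprB. Qed.

(** The Jacobi identity with [f0], read at the origin; the second derivatives of [f0] cancel by
    symmetry of [Phi]. *)
Lemma beta_jacobi i j : beta i.+1 j + beta i j.+1 = beta i j *m A.
Proof.
rewrite /beta /= !(mulmxDr, mulmxBl, mulmxBr, mulmxN) !mulmxA (Phi_sym (kl i)).
set a1 := kl i *m A *m jc j; set a2 := kl j *m jc i *m A.
set a3 := kl j *m A *m jc i; set a4 := kl j *m Phi _; set a5 := kl i *m jc j *m A.
by apply/rowP => l; rewrite !mxE; ring.
Qed.

Section span.
Variables (m : nat) (S : 'M[R]_(m, n)).
Hypothesis AS : (S *m A <= S)%MS.

(** Induction on the gap j - i, two consecutive gaps at a time: gap 0 gives zero, gap 1 a drift, and
    [beta_jacobi] yields gap d + 2 from gaps d + 1 and d. The drift [dr k] has index sum 2 k - 1. *)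
Lemma beta_sub N : (forall k, (0 < k)%N -> (k.*2 <= N.+1)%N -> (dr k <= S)%MS) ->
  forall i j, (i + j <= N)%N -> (beta i j <= S)%MS.
Proof.
move=> drS.
have main d : forall i, (i.*2 + d <= N)%N -> (beta i (i + d) <= S)%MS /\
    ((i.*2 + d.+1 <= N)%N -> (beta i (i + d.+1) <= S)%MS).
  elim: d => [|d IH] i iN.
    split; first by rewrite addn0 /beta subrr sub0mx.
    by rewrite !addn1 => iN'; exact: (drS i.+1).
  have h1 : (i.*2 + d <= N)%N by rewrite (leq_trans _ iN)// leq_add2l.
  have [IH1 IH2] := IH i h1; split; first exact: IH2.
  move=> iN'.
  have -> : beta i (i + d.+2) = beta i (i + d.+1) *m A - beta i.+1 (i.+1 + d).
    by rewrite -beta_jacobi addSn !addnS addrC addKr.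
  apply: addmx_sub.
    by apply: submx_trans AS; apply: submxMr; exact: IH2.
  rewrite eqmx_opp; apply: (IH i.+1 _).1.
  by rewrite doubleS !addSn -!addnS.
move=> i j; wlog ij : i j / (i <= j)%N.
  move=> wl ijN; have [ij|/ltnW ji] := leqP i j; first exact: wl.
  by rewrite betaC eqmx_opp; apply: wl; rewrite // addnC.
move=> ijN; rewrite -(subnKC ij); apply: (main _ _ _).1.
by rewrite -addnn -addnA subnKC.
Qed.

(** [dr k.+1] has index sum 2 k + 1, one beyond what [beta_sub] covers. The relation between the
    [kl] says nothing about the [jc], so it is applied twice: expand one [kl], exchange indices
    modulo [S] to bring up the other, expand again. All index sums are then at most 2 k, and both
    halves become the same double sum modulo [S]. *)
Lemma dependent_drift_sub k : (kl k <= kal_mx k)%MS ->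
  (forall j, (0 < j)%N -> (j <= k)%N -> (dr j <= S)%MS) -> (dr k.+1 <= S)%MS.
Proof.
move=> /submxP[c cE] drS.
have bS i j : (i + j <= k.*2)%N -> (beta i j <= S)%MS.
  apply: beta_sub => l l0 lk; apply: drS => //.
  by have := half_leq lk; rewrite doubleK /= uphalf_double.
have kE : kl k = \sum_(j < k) c 0 j *: kl j.
  by rewrite cE mulmx_sum_row; apply: eq_bigr => j _; rewrite rowK.
have kE1 : kl k.+1 = \sum_(j < k) c 0 j *: kl j.+1.
  by rewrite /= kE mulmx_suml; apply: eq_bigr => j _; rewrite -scalemxAl.
have [Pi [PiS _ _]] := stable_projector AS.
have bPi i j : (i + j <= k.*2)%N -> kl i *m jc j *m Pi = kl j *m jc i *m Pi.
  by move=> /bS; rewrite -PiS mulmxBl subr_eq0 => /eqP.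
rewrite -PiS -[dr k.+1]/(kl k *m jc k.+1 - kl k.+1 *m jc k) mulmxBl subr_eq0.
have -> : kl k *m jc k.+1 *m Pi =
    \sum_(j < k) \sum_(l < k) (c 0 j * c 0 l) *: (kl l.+1 *m jc j *m Pi).
  rewrite {1}kE !mulmx_suml; apply: eq_bigr => j _.
  rewrite -!scalemxAl bPi; last by rewrite -addnn addnS -addSn leq_add2r.
  rewrite kE1 !mulmx_suml scaler_sumr; apply: eq_bigr => l _.
  by rewrite -!scalemxAl scalerA.
have -> : kl k.+1 *m jc k *m Pi =
    \sum_(l < k) \sum_(j < k) (c 0 j * c 0 l) *: (kl j *m jc l.+1 *m Pi).
  rewrite {1}kE1 !mulmx_suml; apply: eq_bigr => l _.
  rewrite -!scalemxAl bPi; last by rewrite -addnn leq_add2r.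
  rewrite kE !mulmx_suml scaler_sumr; apply: eq_bigr => j _.
  by rewrite -!scalemxAl scalerA mulrC.
rewrite exchange_big; apply/eqP; apply: eq_bigr => l _; apply: eq_bigr => j _.
rewrite bPi// -addnn addSn -addnS; apply: leq_add => //; exact: ltnW.
Qed.

End span.

Lemma all_beta_sub m (S : 'M[R]_(m, n)) : (S *m A <= S)%MS ->
  (forall k, (dr k <= S)%MS) -> forall i j, (beta i j <= S)%MS.
Proof. by move=> AS drS i j; exact: (beta_sub AS (fun k _ _ => drS k) (leqnn _)). Qed.

Lemma stlc_drift_sub (f : 'rV[R]_n * R -> 'rV[R]_n) (Cq r : R) m (S : 'M[R]_(m, n)) :
  continuous f -> smoothly_STLC f ->
  0 < r -> 0 <= Cq ->
  (forall c (x : 'rV[R]_n) u, c <= r -> `|x| <= c -> `|u| <= c ->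
    `|f (x, u) - x *m A - u *: b| <= Cq * c ^+ 2 /\
    `|f (x, u) - x *m A - u *: b - quad H q Phi x u| <= Cq * c ^+ 3) ->
  (S *m A <= S)%MS -> (forall i, (kl i <= S)%MS) ->
  forall k, (dr k <= S)%MS.
Proof.
move=> cf hc r0 Cq0 taylor AS klS k.
have [Pi [PiS PiA PiPi]] := stable_projector AS.
elim/ltn_ind: k => k IH.
have [fk|] := boolP (row_free (kal_mx k)).
  have [Cf Cf0 free] := kal_free_bound fk.
  rewrite -PiS; apply/eqP.
  apply: (stlc_drift_zero cf hc r0 Cq0 taylor Phi_sym _ PiA PiPi _ Cf0 free).
    by move=> i; apply/eqP; rewrite PiS.
  by move=> i ik; apply/eqP; rewrite PiS; exact: IH.
case: k IH => [|k] IH nf; first by move: nf; rewrite /row_free -leqn0 rank_leq_row.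
apply: (dependent_drift_sub AS); last by move=> j _ jk; exact: IH.
(* The first dependence may occur before [k]; multiplication by [A] propagates it to [k]. *)
have [l lk ll] : exists2 l, (l < k.+1)%N & (kl l <= kal_mx l)%MS.
  apply: contrapT => h; move/negP: nf; apply; apply: kal_free => l lk lB.
  by apply: h; exists l.
by rewrite -(subnKC (lk : (l <= k)%N)); exact: kal_dependent.
Qed.

End kalman_space.

(** * Smooth maps *)

Section smooth_scalar.
Context {R : realType} {V : normedModType R}.
Implicit Types (g h : V -> R).

Lemma smooth_derive {W : normedModType R} (g : V -> W) v : smooth g ->
  smooth ('D_v g).
Proof. by move=> sg k; have [_] := sg k.+1; exact. Qed.

Lemma smooth_differentiable {W : normedModType R} (g : V -> W) : smooth g ->
  forall x, differentiable g x.
Proof. by move=> sg; have [] := sg 1%N. Qed.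

Lemma smooth_derivable {W : normedModType R} (g : V -> W) x v : smooth g ->
  derivable g x v.
Proof. by move=> sg; apply: diff_derivable; exact: smooth_differentiable. Qed.

Lemma smooth_continuous {W : normedModType R} (g : V -> W) : smooth g -> continuous g.
Proof. by move=> sg; exact: (sg 0%N). Qed.

Lemma smooth_cst {W : normedModType R} (c : W) : smooth (fun _ : V => c).
Proof.
move=> k; elim: k c => [|k IH] c; first exact: cst_continuous.
split=> [x|v]; first exact: differentiable_cst.
have -> : 'D_v (fun _ : V => c) = (fun _ : V => 0).
  by apply/funext => x; exact: derive_cst.
exact: IH.
Qed.

Lemma CkD {W : normedModType R} k (g h : V -> W) :
  Ck k g -> Ck k h -> Ck k (fun x => g x + h x).
Proof.
elim: k g h => [|k IH] g h.
  by move=> cg ch x; apply: cvgD; [exact: cg|exact: ch].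
move=> [dg sg] [dh sh]; split=> [x|v]; first by apply: differentiableD.
have -> : 'D_v (fun x => g x + h x) = (fun x => 'D_v g x + 'D_v h x).
  by apply/funext => x; apply: deriveD; exact: diff_derivable.
by apply: IH; [exact: sg|exact: sh].
Qed.

Lemma smoothD {W : normedModType R} (g h : V -> W) :
  smooth g -> smooth h -> smooth (fun x => g x + h x).
Proof. by move=> sg sh k; exact: CkD. Qed.

(** The induction keeps both factors smooth rather than [Ck k], because the product rule leaves one
    of them undifferentiated. *)
Lemma smoothM g h : smooth g -> smooth h -> smooth (fun x => g x * h x).
Proof.
move=> sg sh k; elim: k g h sg sh => [|k IH] g h sg sh.
  by move=> x; apply: cvgM; apply: smooth_continuous.
split=> [x|v].
  by apply: differentiableM; exact: smooth_differentiable.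
have -> : 'D_v (fun x => g x * h x) = (fun x => g x * 'D_v h x + h x * 'D_v g x).
  by apply/funext => x; apply: deriveM; exact: smooth_derivable.
by apply: CkD; apply: IH => //; exact: smooth_derive.
Qed.

Lemma smoothN g : smooth g -> smooth (fun x => - g x).
Proof.
move=> sg; have -> : (fun x => - g x) = (fun x => (-1) * g x).
  by apply/funext => x; rewrite mulN1r.
by apply: smoothM => //; exact: smooth_cst.
Qed.

Lemma smooth_sum {I : Type} (r : seq I) (g : I -> V -> R) :
  (forall i, smooth (g i)) -> smooth (fun x => \sum_(i <- r) g i x).
Proof.
move=> sg; elim: r => [|i r IH].
  have -> : (fun x => \sum_(i <- [::]) g i x) = (fun _ => 0).
    by apply/funext => x; rewrite big_nil.
  exact: smooth_cst.
have -> : (fun x => \sum_(j <- i :: r) g j x) =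
    (fun x => g i x + \sum_(j <- r) g j x).
  by apply/funext => x; rewrite big_cons.
exact: smoothD.
Qed.

Lemma derive_line {W : normedModType R} (g : V -> W) (p v : V) (s : R) :
  differentiable g (p + s *: v) ->
  is_derive s (1 : R) (fun t => g (p + t *: v)) ('D_v g (p + s *: v)).
Proof.
move=> dg.
have dL : is_diff s (fun t : R => p + t *: v) (0 + *:%R^~ v).
  by apply: is_diffD.
have dL' : differentiable (fun t : R => p + t *: v) s by exact: ex_diff.
have dc : differentiable (g \o (fun t : R => p + t *: v)) s.
  exact: differentiable_comp.
apply: DeriveDef; first exact: diff_derivable.
by rewrite deriveE// diff_comp//= deriveE// diff_val /= fctE add0r scale1r.
Qed.

End smooth_scalar.

Section smooth_coordinates.
Context {R : realType} {V : normedModType R} {n : nat}.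

Lemma derive_coord (f : V -> 'rV[R]_n) i v x : differentiable f x ->
  'D_v (fun y => f y 0 i) x = 'D_v f x 0 i.
Proof. by move=> df; rewrite derive_mx ?mxE//; exact: diff_derivable. Qed.

Lemma smooth_coord (f : V -> 'rV[R]_n) i : smooth f -> smooth (fun x => f x 0 i).
Proof.
move=> sf k; elim: k f sf => [|k IH] f sf.
  move=> x; apply: (@continuous_comp _ _ _ f (fun M => M 0 i)).
    exact: smooth_continuous.
  exact: coord_continuous.
split=> [x|v].
  apply: (@differentiable_comp _ _ _ _ f (fun M : 'rV[R]_n => M 0 i)).
    exact: smooth_differentiable.
  exact: differentiable_coord.
have -> : 'D_v (fun x => f x 0 i) = (fun x => 'D_v f x 0 i).
  by apply/funext => x; apply: derive_coord; exact: smooth_differentiable.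
by apply: IH; exact: smooth_derive.
Qed.

Lemma coord_differentiable (f : V -> 'rV[R]_n) x :
  (forall i, differentiable (fun y => f y 0 i) x) -> differentiable f x.
Proof.
move=> df.
have -> : f = \sum_i (fun y => f y 0 i *: delta_mx 0 i).
  by apply/funext => y; rewrite fct_sumE -row_sum_delta.
by apply: differentiable_sum => i; exact: differentiableZl.
Qed.

Lemma line_vderiv (f : V -> 'rV[R]_n) (p v : V) T : smooth f ->
  has_vderiv T (fun s => f (p + s *: v)) (fun s => 'D_v f (p + s *: v)).
Proof.
move=> sf i s _.
rewrite -derive_coord; last exact: smooth_differentiable.
by apply: derive_line; apply: smooth_differentiable; exact: smooth_coord.
Qed.

(* Both mixed derivatives approximate the same second difference of [f]. *)
Lemma derive_commute (f : V -> 'rV[R]_n) (v w p : V) : smooth f ->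
  'D_w ('D_v f) p = 'D_v ('D_w f) p.
Proof.
move=> sf.
have main (a b : V) (e : R) : 0 < e -> exists2 d, 0 < d & forall h, 0 < h -> h < d ->
    `|f (p + h *: a + h *: b) - f (p + h *: a) - f (p + h *: b) + f p
      - (h ^+ 2) *: 'D_b ('D_a f) p| <= e * h ^+ 2.
  move=> e0.
  have cD : continuous ('D_b ('D_a f)).
    by apply: smooth_continuous; do 2!apply: smooth_derive.
  have /cvgrPdist_lt/(_ e e0) := cD p; rewrite nearE /= => /nbhs_ballP[d /= d0 dP].
  pose N := `|a| + `|b| + 1.
  have N0 : 0 < N by rewrite ltr_pwDr// addr_ge0.
  exists (d / N); first exact: divr_gt0.
  move=> h h0 hd; have h0' := ltW h0.
  have hN : h * N < d by rewrite -ltr_pdivlMr.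
  have near s t : 0 <= s <= h -> 0 <= t <= h ->
      `|'D_b ('D_a f) (p + s *: a + t *: b) - 'D_b ('D_a f) p| <= e.
    move=> /andP[s0 sh] /andP[t0 th]; rewrite distrC; apply/ltW/dP.
    rewrite -ball_normE /= -addrA opprD addrA subrr add0r normrN.
    apply: le_lt_trans (ler_normD _ _) _; rewrite !normrZ !ger0_norm//.
    apply: le_lt_trans hN; rewrite /N !mulrDr mulr1.
    by rewrite -[leLHS]addr0 lerD// lerD// ler_wpM2r.
  set M := 'D_b ('D_a f) p.
  have hh : 0 <= h <= h by rewrite lexx h0'.
  (* The mean value inequality is applied first along [b], then along [a]. *)
  have inner s : 0 <= s <= h ->
      `|'D_a f (p + s *: a + h *: b) - 'D_a f (p + s *: a) - h *: M| <= e * h.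
    move=> sh.
    have d1 := has_vderivB (line_vderiv (T := h) (p + s *: a) b (smooth_derive a sf))
      (has_vderiv_scalel M (@has_deriv_id _ h)).
    have d2 : has_deriv h (fun t => e * t) (fun t => e * 1).
      by apply: has_derivZ; exact: has_deriv_id.
    have := has_vderiv_norm h0' d1 d2 _ hh.
    rewrite !scale0r subr0 addr0 mulr0 subr0 /= => H.
    rewrite -addrAC; apply: H => t th; rewrite scale1r mulr1; exact: near.
  have d1 := has_vderivB (has_vderivB (line_vderiv (T := h) (p + h *: b) a sf)
      (line_vderiv (T := h) p a sf)) (has_vderiv_scalel (h *: M) (@has_deriv_id _ h)).
  have d2 : has_deriv h (fun t => e * h * t) (fun t => e * h * 1).
    by apply: has_derivZ; exact: has_deriv_id.
  have := has_vderiv_norm h0' d1 d2 _ hh.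
  rewrite !scale0r !subr0 !addr0 mulr0 subr0 /= => H.
  have {}H : `|f (p + h *: b + h *: a) - f (p + h *: a) - h *: (h *: M)
     - (f (p + h *: b) - f p)| <= e * h * h.
    apply: H => t th; rewrite scale1r mulr1 [p + _ + _]addrAC; exact: inner.
  rewrite expr2 mulrA -scalerA [p + _ + _]addrAC.
  apply: le_trans H; rewrite le_eqVlt; apply/orP; left; apply/eqP; congr (`|_|).
  by apply/rowP => i; rewrite !mxE; ring.
apply/eqP; rewrite -subr_eq0 -normr_eq0 eq_le normr_ge0 andbT.
apply/ler_addgt0Pr => e e0; rewrite add0r.
have e2 : 0 < e / 2 by rewrite divr_gt0.
have [d1 d10 H1] := main v w _ e2; have [d2 d20 H2] := main w v _ e2.
pose h := Num.min d1 d2 / 2.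
have h0 : 0 < h by rewrite divr_gt0// lt_min d10.
have hm : h < Num.min d1 d2 by rewrite ltr_pdivrMr// mulr_natr mulr2n ltrDl lt_min d10.
have hd1 : h < d1 by rewrite (lt_le_trans hm)// ge_min lexx.
have hd2 : h < d2 by rewrite (lt_le_trans hm)// ge_min lexx orbT.
have {}H1 := H1 h h0 hd1; have {}H2 := H2 h h0 hd2.
have h20 : 0 < h ^+ 2 by rewrite exprn_gt0.
rewrite -(ler_pM2l h20) -{1}(gtr0_norm h20) -normrZ.
have -> : h ^+ 2 * e = e / 2 * h ^+ 2 + e / 2 * h ^+ 2 by field.
apply: le_trans (lerD H2 H1); apply: le_trans (ler_normB _ _).
rewrite le_eqVlt; apply/orP; left; apply/eqP; congr (`|_|).
rewrite [p + h *: w + h *: v]addrAC.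
move: ('D_w ('D_v f) p) ('D_v ('D_w f) p) (f _) (f _) (f _) (f _) => D1 D2 f1 f2 f3 f4.
by apply/rowP => i; rewrite !mxE; ring.
Qed.

End smooth_coordinates.

Lemma locally_bounded {R : realType} {V W : normedModType R} (J : finType)
    (g : J -> V -> W) : (forall j, continuous (g j)) ->
  exists2 r : R, 0 < r & exists2 B : R, 0 <= B &
    forall p j, `|p| <= r -> `|g j p| <= B.
Proof.
move=> cg.
have : \forall p \near (0 : V), forall j, `|g j p| <= `|g j 0| + 1.
  apply: filter_forall => j; near=> p.
  have : `|g j 0 - g j p| < 1.
    by near: p; have /cvgrPdist_lt/(_ 1 ltr01) := cg j 0.
  move=> h; rewrite -[g j p](subKr (g j 0)) (le_trans (ler_normB _ _))// lerD2l.
  exact: ltW.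
move=> /nbhs_ballP[d /= d0 dP].
exists (d / 2); first exact: divr_gt0.
exists (\sum_j (`|g j 0| + 1)); first by apply: sumr_ge0 => j _; exact: addr_ge0.
move=> p j pd; apply: le_trans (_ : `|g j 0| + 1 <= _).
  apply: dP; rewrite -ball_normE /= sub0r normrN (le_lt_trans pd)//.
  by rewrite ltr_pdivrMr// mulr_natr mulr2n ltrDl.
by rewrite (bigD1 j)//= lerDl sumr_ge0// => i _; exact: addr_ge0.
Unshelve. all: by end_near. Qed.

(** * Second order Taylor expansion at the origin *)

Section taylor.
Context {R : realType} {V : normedModType R} {n : nat} {J : finType}.
Variables (e : J -> V) (co : J -> V -> R).
Hypothesis coE : forall p, p = \sum_j co j p *: e j.
Hypothesis co_le : forall j p, `|co j p| <= `|p|.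

Lemma derive_basis {W : normedModType R} (g : V -> W) p x : differentiable g x ->
  'D_p g x = \sum_j co j p *: 'D_(e j) g x.
Proof.
move=> dg; rewrite deriveE// {1}(coE p) linear_sum; apply: eq_bigr => j _.
by rewrite linearZ /= deriveE.
Qed.

Lemma derive_basis_le {W : normedModType R} (g : V -> W) p x B : differentiable g x ->
  (forall j, `|'D_(e j) g x| <= B) -> `|'D_p g x| <= #|J|%:R * (`|p| * B).
Proof.
move=> dg gB; rewrite derive_basis//; apply: le_trans (ler_norm_sum _ _ _) _.
rewrite -sum1_card natr_sum mulr_suml; apply: ler_sum => j _.
by rewrite mul1r normrZ; apply: ler_pM.
Qed.

Lemma taylor_bound (f : V -> 'rV[R]_n) : smooth f ->
  exists2 r : R, 0 < r & exists2 C : R, 0 <= C & forall p, `|p| <= r ->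
    `|f p - f 0 - 'D_p f 0| <= C * `|p| ^+ 2 /\
    `|f p - f 0 - 'D_p f 0 - 2^-1 *: 'D_p ('D_p f) 0| <= C * `|p| ^+ 3.
Proof.
move=> sf.
have [r2 r20 [B2 B20 H2]] := locally_bounded (g := fun ij : J * J => 'D_(e ij.1) ('D_(e ij.2) f))
   (fun ij => smooth_continuous (smooth_derive _ (smooth_derive _ sf))).
have [r3 r30 [B3 B30 H3]] := locally_bounded
  (g := fun ij : J * J * J => 'D_(e ij.1.1) ('D_(e ij.1.2) ('D_(e ij.2) f)))
   (fun ij => smooth_continuous (smooth_derive _ (smooth_derive _ (smooth_derive _ sf)))).
pose N : R := #|J|%:R; have N0 : 0 <= N by exact: ler0n.
exists (Num.min r2 r3); first by rewrite lt_min r20.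
exists (N ^+ 2 * B2 + N ^+ 3 * B3).
  by rewrite addr_ge0// mulr_ge0// exprn_ge0.
move=> p; rewrite le_min => /andP[pr2 pr3].
have D2 x : `|x| <= r2 -> `|'D_p ('D_p f) x| <= N ^+ 2 * B2 * `|p| ^+ 2.
  move=> xr; have -> : N ^+ 2 * B2 * `|p| ^+ 2 = N * (`|p| * (N * (`|p| * B2))) by ring.
  apply: derive_basis_le => [|j].
    by apply: smooth_differentiable; exact: smooth_derive.
  (* Only the outermost direction can be expanded in the basis; commuting brings the remaining [p]
     outside. *)
  rewrite derive_commute//; apply: derive_basis_le => [|i].
    by apply: smooth_differentiable; exact: smooth_derive.
  exact: (H2 x (i, j)).
have D3 x : `|x| <= r3 -> `|'D_p ('D_p ('D_p f)) x| <= N ^+ 3 * B3 * `|p| ^+ 3.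
  move=> xr.
  have -> : N ^+ 3 * B3 * `|p| ^+ 3 = N * (`|p| * (N * (`|p| * (N * (`|p| * B3))))) by ring.
  have sD q g : smooth g -> smooth ('D_q g) by exact: smooth_derive.
  apply: derive_basis_le => [|j]; first by apply: smooth_differentiable;
    do 2!apply: (sD).
  rewrite derive_commute; last exact: sD.
  apply: derive_basis_le => [|i]; first by apply: smooth_differentiable;
    do 2!apply: (sD).
  have -> : 'D_(e j) ('D_p f) = 'D_p ('D_(e j) f).
    by apply/funext => y; exact: derive_commute.
  rewrite derive_commute; last exact: sD.
  apply: derive_basis_le => [|l]; first by apply: smooth_differentiable;
    do 2!apply: (sD).
  exact: (H3 x (l, i, j)).
have line_le (r s : R) : `|p| <= r -> 0 <= s <= 1 -> `|0 + s *: p| <= r.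
  move=> pr /andP[s0 s1]; rewrite add0r normrZ ger0_norm//.
  by apply: le_trans pr; rewrite ler_piMl.
have I01 : (0 : R) <= (1 : R) <= (1 : R) by rewrite ler01 lexx.
have l0 := line_vderiv (T := 1) 0 p sf.
have l1 := line_vderiv (T := 1) 0 p (smooth_derive p sf).
have l2 := line_vderiv (T := 1) 0 p (smooth_derive p (smooth_derive p sf)).
have lin (c : R) : has_deriv (1 : R) (fun s => c * s) (fun=> c).
  by apply: has_deriv_congr (has_derivZ c (@has_deriv_id _ 1)) => // s; rewrite mulr1.
have lin_le (c s : R) : 0 <= c -> 0 <= s <= 1 -> c * s <= c.
  by move=> c0 /andP[_ s1]; rewrite ler_piMr.
set c2 := N ^+ 2 * B2 * `|p| ^+ 2 in D2 *; set c3 := N ^+ 3 * B3 * `|p| ^+ 3 in D3 *.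
have c20 : 0 <= c2 by rewrite !mulr_ge0// exprn_ge0.
have c30 : 0 <= c3 by rewrite !mulr_ge0// exprn_ge0.
have E1 (s : R) : 0 <= s <= 1 -> `|'D_p f (0 + s *: p) - 'D_p f 0| <= c2.
  move=> sI; apply: (@le_trans _ _ (c2 * s)); last exact: lin_le.
  have := has_vderiv_norm ler01 l1 (lin c2) _ sI.
  rewrite scale0r addr0 mulr0 subr0; apply => t tI.
  by apply: D2; exact: line_le.
have E2 (s : R) : 0 <= s <= 1 ->
  `|'D_p ('D_p f) (0 + s *: p) - 'D_p ('D_p f) 0| <= c3.
  move=> sI; apply: (@le_trans _ _ (c3 * s)); last exact: lin_le.
  have := has_vderiv_norm ler01 l2 (lin c3) _ sI.
  rewrite scale0r addr0 mulr0 subr0; apply => t tI.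
  by apply: D3; exact: line_le.
have F1 : `|f p - f 0 - 'D_p f 0| <= c2.
  have d := has_vderivB l0 (has_vderiv_scalel ('D_p f 0) (@has_deriv_id _ 1)).
  have := has_vderiv_norm ler01 d (lin c2) _ I01.
  rewrite !scale0r !scale1r !add0r subr0 mulr0 mulr1 subr0 addrAC; apply => t tI.
  exact: E1.
have E3 (s : R) : 0 <= s <= 1 ->
    `|'D_p f (0 + s *: p) - 'D_p f 0 - s *: 'D_p ('D_p f) 0| <= c3.
  move=> sI; apply: (@le_trans _ _ (c3 * s)); last exact: lin_le.
  have d := has_vderivB l1 (has_vderiv_scalel ('D_p ('D_p f) 0) (@has_deriv_id _ 1)).
  have := has_vderiv_norm ler01 d (lin c3) _ sI.
  rewrite !scale0r addr0 subr0 mulr0 subr0 addrAC; apply => t tI.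
  by rewrite scale1r; exact: E2.
have F2 : `|f p - f 0 - 'D_p f 0 - 2^-1 *: 'D_p ('D_p f) 0| <= c3.
  have hs : has_deriv (1 : R) (fun s => 2^-1 * (s * s)) (fun s => s).
    apply: has_deriv_congr (has_derivZ 2^-1 (has_derivM (@has_deriv_id _ 1) (@has_deriv_id _ 1))) => // s.
    by field.
  have d := has_vderivB (has_vderivB l0 (has_vderiv_scalel ('D_p f 0) (@has_deriv_id _ 1)))
     (has_vderiv_scalel ('D_p ('D_p f) 0) hs).
  have := has_vderiv_norm ler01 d (lin c3) _ I01.
  rewrite !mulr0 !scale0r !mulr1 !scale1r !add0r !subr0 => H.
  have {}H : `|f p - 'D_p f 0 - 2^-1 *: 'D_p ('D_p f) 0 - f 0| <= c3.
    by apply: H => t tI; exact: E3.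
  by move: H; rewrite addrAC (addrAC (f p)).
have p0 : 0 <= `|p| ^+ 2 by exact: exprn_ge0.
have p30 : 0 <= `|p| ^+ 3 by exact: exprn_ge0.
split; [apply: le_trans F1 _|apply: le_trans F2 _]; rewrite ler_wpM2r//.
  by rewrite lerDl mulr_ge0// exprn_ge0.
by rewrite lerDr mulr_ge0// exprn_ge0.
Qed.

End taylor.

Section product_basis.
Context {R : realType} {n : nat}.
Local Notation V := ('rV[R]_n * R)%type.

(** Index [ord0] is the control direction; the lifted indices are the state directions. *)
Definition prod_basis (j : 'I_n.+1) : V :=
  if unlift ord0 j is Some i then (delta_mx 0 i, 0) else (0, 1).

Definition prod_coord (j : 'I_n.+1) (p : V) : R :=
  if unlift ord0 j is Some i then p.1 0 i else p.2.

Lemma prod_coordE (p : V) : p = \sum_j prod_coord j p *: prod_basis j.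
Proof.
rewrite big_ord_recl /prod_coord /prod_basis unlift_none.
under eq_bigr do rewrite liftK.
case: p => x u /=.
have -> : \sum_(i < n) x 0 i *: ((delta_mx 0 i, 0) : V) = (x, 0).
  rewrite [in RHS](row_sum_delta x).
  elim/big_ind2: _ => // [|i _]; last by congr pair; rewrite /= scaler0.
  by move=> a b c d -> -> ; congr pair; rewrite /= addr0.
by congr pair; rewrite /= ?scaler0 ?add0r// addr0 [_%:A]mulr1.
Qed.

Lemma prod_coord_le j (p : V) : `|prod_coord j p| <= `|p|.
Proof.
rewrite prod_normE /prod_coord; case: unlift => [i|].
  by rewrite le_max rV_coord_le.
by rewrite le_max lexx orbT.
Qed.

End product_basis.

Definition row_mx_of {R : realType} {n : nat} (L : 'rV[R]_n -> 'rV[R]_n) : 'M[R]_n :=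
  \matrix_i L (delta_mx 0 i).

Lemma row_mx_ofE {R : realType} {n : nat} (L : 'rV[R]_n -> 'rV[R]_n) x :
  linear L -> x *m row_mx_of L = L x.
Proof.
move=> Llin; rewrite mulmx_sum_row [in RHS](row_sum_delta x).
have L0 : L 0 = 0 by have := Llin (-1) 0 0; rewrite scaler0 add0r scaleN1r addNr.
have LD u v : L (u + v) = L u + L v by rewrite -[u]scale1r Llin !scale1r.
have LZ a u : L (a *: u) = a *: L u by rewrite -[a *: u]addr0 Llin L0 addr0.
rewrite (big_morph L LD L0); apply: eq_bigr => i _.
by rewrite rowK LZ.
Qed.

(** * The coefficients of the second order expansion of the system *)

Section system.
Context {R : realType} {n : nat}.
Variable f : 'rV[R]_n * R -> 'rV[R]_n.
Hypothesis sf : smooth f.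
Local Notation V := ('rV[R]_n * R)%type.
Local Notation W := ('rV[R]_n).

Let sD (g : V -> W) v : smooth g -> smooth ('D_v g).
Proof. exact: smooth_derive. Qed.

Lemma pair_split (x : W) (u : R) : (x, u) = (x, 0) + u *: ((0, 1) : V).
Proof. by congr pair; rewrite /= ?scaler0 ?addr0// add0r [_%:A]mulr1. Qed.

Lemma derive_lin (g : V -> W) p a v w : smooth g ->
  'D_(a *: v + w) g p = a *: 'D_v g p + 'D_w g p.
Proof.
by move=> sg; rewrite !deriveE ?linearP//; exact: smooth_differentiable.
Qed.

Lemma derive_row_lin (g : V -> W) p : smooth g -> linear (fun x : W => 'D_(x, 0) g p).
Proof.
move=> sg a v w; rewrite -(derive_lin p a (v, 0) (w, 0) sg); congr ('D_ _ g p).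
by congr pair; rewrite /= scaler0 addr0.
Qed.

Definition linA := row_mx_of (fun x => 'D_(x, 0) f 0).
Definition vecb := 'D_(0, 1) f 0.
Definition matH := row_mx_of (fun x => 'D_(x, 0) ('D_(0, 1) f) 0).
Definition vecq := 'D_(0, 1) ('D_(0, 1) f) 0.
Definition bilPhi (x : W) := row_mx_of (fun y => 'D_(y, 0) ('D_(x, 0) f) 0).

Lemma linAE x : x *m linA = 'D_(x, 0) f 0.
Proof. by rewrite row_mx_ofE//; exact: derive_row_lin. Qed.

Lemma matHE x : x *m matH = 'D_(x, 0) ('D_(0, 1) f) 0.
Proof. by rewrite row_mx_ofE//; exact/derive_row_lin/sD. Qed.

Lemma bilPhiE x y : y *m bilPhi x = 'D_(y, 0) ('D_(x, 0) f) 0.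
Proof. by rewrite row_mx_ofE//; exact/derive_row_lin/sD. Qed.

Lemma bilPhi_sym x y : x *m bilPhi y = y *m bilPhi x.
Proof. by rewrite !bilPhiE; exact: (@derive_commute R V n f (y, 0) (x, 0) 0 sf). Qed.

Lemma derive_pair (g : V -> W) x u p : smooth g ->
  'D_(x, u) g p = 'D_(x, 0) g p + u *: 'D_(0, 1) g p.
Proof. by move=> sg; rewrite pair_split addrC derive_lin// addrC. Qed.

Lemma bilinear_expand (B : V -> V -> W) x u :
  (forall v w, B v w = B w v) ->
  (forall w, B (x, u) w = B (x, 0) w + u *: B (0, 1) w) ->
  2^-1 *: B (x, u) (x, u) =
    2^-1 *: B (x, 0) (x, 0) + u *: B (x, 0) (0, 1) + (u ^+ 2 / 2) *: B (0, 1) (0, 1).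
Proof.
move=> Bsym Blin.
rewrite Blin (Bsym (x, 0)) (Bsym (0, 1)) !Blin (Bsym (0, 1) (x, 0)).
move: (B (x, 0) (x, 0)) (B (x, 0) (0, 1)) (B (0, 1) (0, 1)) => a1 a2 a3.
by apply/rowP => i; rewrite !mxE; field.
Qed.

Lemma derive2_pair x u :
  2^-1 *: 'D_(x, u) ('D_(x, u) f) 0 = quad matH vecq bilPhi x u.
Proof.
apply: etrans (@bilinear_expand (fun v w => 'D_v ('D_w f) 0) x u _ _) _ => [v w|w|].
- exact: (@derive_commute R V n f w v 0 sf).
- exact: (derive_pair x u 0 (sD w sf)).
- rewrite /quad; congr (_ + _ + _); congr (_ *: _).
    exact: esym (bilPhiE x x).
  exact: esym (matHE x).
Qed.

Lemma system_taylor : f (0, 0) = 0 ->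
  exists2 r : R, 0 < r & exists2 C : R, 0 <= C &
  forall c (x : W) (u : R), c <= r -> `|x| <= c -> `|u| <= c ->
    `|f (x, u) - x *m linA - u *: vecb| <= C * c ^+ 2 /\
    `|f (x, u) - x *m linA - u *: vecb - quad matH vecq bilPhi x u| <= C * c ^+ 3.
Proof.
move=> f00.
have [r r0 [C C0 HC]] := taylor_bound prod_coordE prod_coord_le sf.
exists r => //; exists C => // c x u cr xc uc.
have pc : `|((x, u) : V)| <= c by rewrite prod_normE /= ge_max xc.
have [h1 h2] := HC (x, u) (le_trans pc cr).
have c0 : 0 <= c by exact: le_trans xc.
rewrite -addrA -opprD linAE -derive_pair// -derive2_pair.
move: h1 h2; rewrite f00 subr0 => h1 h2.
by split; [apply: le_trans h1 _|apply: le_trans h2 _];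
  rewrite ler_wpM2l// lerXn2r// nnegrE.
Qed.

End system.

(** * Smooth vector fields and derivatives of Lie brackets *)

Section vector_fields.
Context {R : realType} {n : nat}.
Local Notation W := ('rV[R]_n).
Implicit Types X Y : W -> W.

Definition smooth_field X := forall i, smooth (fun x => X x 0 i).

Lemma field_differentiable X x : smooth_field X -> differentiable X x.
Proof.
by move=> sX; apply: coord_differentiable => i; apply: smooth_differentiable.
Qed.

Lemma derive_rowE (g : W -> R) v x : smooth g ->
  'D_v g x = \sum_j v 0 j * 'D_(delta_mx 0 j) g x.
Proof.
move=> sg; have dg := smooth_differentiable sg x.
rewrite deriveE// {1}(row_sum_delta v) linear_sum; apply: eq_bigr => j _.
by rewrite linearZ /= deriveE.
Qed.

Lemma smooth_along X (g : W -> R) : smooth_field X -> smooth g ->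
  smooth (fun x => 'D_(X x) g x).
Proof.
move=> sX sg.
have -> : (fun x => 'D_(X x) g x) = (fun x => \sum_j X x 0 j * 'D_(delta_mx 0 j) g x).
  by apply/funext => x; exact: derive_rowE.
by apply: smooth_sum => j; apply: smoothM => //; exact: smooth_derive.
Qed.

(** Expanding the moving direction in the canonical basis reduces this to the scalar product
    rule. *)
Lemma derive_along X (g : W -> R) v x : smooth_field X -> smooth g ->
  'D_v (fun y => 'D_(X y) g y) x = 'D_('D_v X x) g x + 'D_v ('D_(X x) g) x.
Proof.
move=> sX sg.
have E z : 'D_z g = (fun x => \sum_j z 0 j * 'D_(delta_mx 0 j) g x).
  by apply/funext => y; exact: derive_rowE.
have -> : (fun y => 'D_(X y) g y) =
    \sum_j (fun y => X y 0 j * 'D_(delta_mx 0 j) g y).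
  by apply/funext => y; rewrite fct_sumE derive_rowE.
have sDg j := smooth_derive (delta_mx 0 j) sg.
rewrite derive_sum => [|j]; last first.
  by apply: smooth_derivable; exact: smoothM.
have -> : 'D_(X x) g = \sum_j (fun y => X x 0 j * 'D_(delta_mx 0 j) g y).
  by apply/funext => y; rewrite fct_sumE derive_rowE.
rewrite derive_sum => [|j]; last first.
  by apply: smooth_derivable; apply: smoothM => //; exact: smooth_cst.
rewrite derive_rowE// -big_split /=; apply: eq_bigr => j _.
have dj := @smooth_derivable _ _ _ _ x v (sDg j).
have dXj := @smooth_derivable _ _ _ _ x v (sX j).
rewrite (deriveM dXj dj).
have dc : derivable (fun _ : W => X x 0 j) x v by exact: derivable_cst.
rewrite (deriveM dc dj).
rewrite (derive_coord _ _ (field_differentiable x sX)).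
have E0 : 'D_v (fun _ : W => X x 0 j) x = 0 by exact: derive_cst.
rewrite /GRing.scale /= E0 mulr0 addr0 addrC; congr (_ + _); exact: mulrC.
Qed.

Lemma lie_coord X Y x i : smooth_field X -> smooth_field Y ->
  lie_bracket X Y x 0 i =
    'D_(X x) (fun y => Y y 0 i) x - 'D_(Y x) (fun y => X y 0 i) x.
Proof.
move=> sX sY; have dX := field_differentiable x sX;
  have dY := field_differentiable x sY.
by rewrite !derive_coord// !deriveE// !mxE.
Qed.

Lemma smooth_lie X Y : smooth_field X -> smooth_field Y ->
  smooth_field (lie_bracket X Y).
Proof.
move=> sX sY i.
have -> : (fun x => lie_bracket X Y x 0 i) = (fun x =>
   'D_(X x) (fun y => Y y 0 i) x + - 'D_(Y x) (fun y => X y 0 i) x).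
  by apply/funext => x; exact: lie_coord.
by apply: smoothD; [|apply: smoothN]; apply: smooth_along.
Qed.

Lemma lieC X Y : lie_bracket Y X = fun x => - lie_bracket X Y x.
Proof. by apply/funext => x; rewrite /lie_bracket opprB. Qed.

(** The value of a bracket involves first derivatives of its arguments, so an induction over nested
    brackets has to carry these along. *)
Lemma derive_lie X Y v x : smooth_field X -> smooth_field Y ->
  'D_v (lie_bracket X Y) x =
    'D_('D_v X x) Y x + 'D_v ('D_(X x) Y) x - 'D_('D_v Y x) X x - 'D_v ('D_(Y x) X) x.
Proof.
move=> sX sY; apply/rowP => i.
have DE Z z : smooth_field Z -> (fun y => 'D_z Z y 0 i) = 'D_z (fun y => Z y 0 i).
  by move=> sZ; apply/funext => y; rewrite derive_coord//;
    exact: field_differentiable.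
have sDf Z z : smooth_field Z -> smooth_field ('D_z Z).
  move=> sZ j; have -> : (fun y => 'D_z Z y 0 j) = 'D_z (fun y => Z y 0 j).
    by apply/funext => y; rewrite derive_coord//; exact: field_differentiable.
  exact: smooth_derive.
rewrite -derive_coord; last exact/field_differentiable/smooth_lie.
have -> : (fun x => lie_bracket X Y x 0 i) =
   (fun x => 'D_(X x) (fun y => Y y 0 i) x) - (fun x => 'D_(Y x) (fun y => X y 0 i) x).
  by apply/funext => y; rewrite lie_coord.
rewrite deriveB; [|by apply: smooth_derivable; exact: smooth_along..].
rewrite (derive_along v x sX (sY i)) (derive_along v x sY (sX i)).
have fin (D1 D2 D3 D4 : W) d1 d2 d3 d4 :
    d1 = D1 0 i -> d2 = D2 0 i -> d3 = D3 0 i -> d4 = D4 0 i ->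
    d1 + d2 - (d3 + d4) = (D1 + D2 - D3 - D4) 0 i.
  by move=> -> -> -> ->; rewrite !mxE opprD addrA.
have cD Z z : smooth_field Z ->
  'D_v ('D_z (fun y => Z y 0 i)) x = 'D_v ('D_z Z) x 0 i.
  move=> sZ; rewrite -(DE Z z sZ); apply: derive_coord.
  exact/field_differentiable/sDf.
apply: fin; [|exact: cD| |exact: cD].
  exact: derive_coord (field_differentiable x sY).
exact: derive_coord (field_differentiable x sX).
Qed.

End vector_fields.

(** * Brackets containing [f1] at most twice *)

Lemma lin_span_sub {R : realType} {n m : nat} (B : set 'rV[R]_n) (S : 'M[R]_(m, n)) v :
  (forall w, B w -> (w <= S)%MS) -> lin_span B v -> (v <= S)%MS.
Proof.
move=> BS [e eB ve]; rewrite (coord_span (X := in_tuple e) ve).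
apply: summx_sub => i _; apply: scalemx_sub; apply: BS; apply: eB.
exact: mem_nth.
Qed.

Section brackets.
Context {R : realType} {n : nat}.
Local Notation W := ('rV[R]_n).
Variables (f0 f1 : W -> W) (A H : 'M[R]_n) (b : W) (Phi : W -> 'M[R]_n).
Hypothesis Phi_sym : forall x y, x *m Phi y = y *m Phi x.
Hypotheses (sf0 : smooth_field f0) (sf1 : smooth_field f1).
Hypotheses (f00 : f0 0 = 0) (df0 : forall v, 'D_v f0 0 = v *m A).
Hypothesis ddf0 : forall v w, 'D_v ('D_w f0) 0 = v *m Phi w.
Hypotheses (f10 : f1 0 = b) (df1 : forall v, 'D_v f1 0 = v *m H).
Local Notation kl := (kal A b).
Local Notation jc := (jac A H b Phi).

Lemma diff0_derive (X : W -> W) v : smooth_field X -> 'd X 0 v = 'D_v X 0.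
Proof. by move=> sX; rewrite deriveE//; exact: field_differentiable. Qed.

(* The 1-jet at the origin of a bracket that contains [f1] once. *)
Definition jet_one (X : W -> W) := smooth_field X /\
  exists i c, X 0 = c *: kl i /\ forall v, 'D_v X 0 = c *: (v *m jc i).

Lemma jet_one_f1 : jet_one f1.
Proof.
by split=> //; exists 0%N, 1; rewrite scale1r; split=> // v; rewrite scale1r df1.
Qed.

Lemma jet_one_cst0 : jet_one (fun=> 0).
Proof.
split.
  move=> i; have -> : (fun _ : W => (0 : W) 0 i) = (fun=> 0).
    by apply/funext => x; rewrite mxE.
  exact: smooth_cst.
exists 0%N, 0; rewrite scale0r; split=> // v; rewrite scale0r; exact: derive_cst.
Qed.

Lemma jet_oneN X : jet_one X -> jet_one (fun x => - X x).
Proof.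
move=> [sX [i [c [X0 dX]]]]; split.
  move=> j; have -> : (fun x => (- X x) 0 j) = (fun x => - X x 0 j).
    by apply/funext => x; rewrite mxE.
  exact: smoothN.
exists i, (- c); split; first by rewrite X0 scaleNr.
move=> v; rewrite scaleNr -dX; apply: (@deriveN _ _ _ X 0 v).
by apply: diff_derivable; exact: field_differentiable.
Qed.

(** The recursions of [kal] and [jac] are, up to sign, the action of the bracket with [f0] on
    1-jets. These suffice because [f0] vanishes at 0, which removes the second derivative of [Y]. *)
Lemma jet_one_lie Y : jet_one Y -> jet_one (lie_bracket f0 Y).
Proof.
move=> [sY [i [c [Y0 dY]]]]; split; first exact: smooth_lie.
exists i.+1, (- c); split.
  have d1 : 'd Y 0 (f0 0) = 0 by rewrite f00; exact: linear0.
  have d2 : 'd f0 0 (Y 0) = c *: kl i.+1.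
    by rewrite diff0_derive// df0 Y0 -scalemxAl.
  by apply: etrans (congr2 (fun x y => x - y) d1 d2) _; rewrite sub0r scaleNr.
move=> v; rewrite (derive_lie v 0 sf0 sY).
have fin (D1 D2 D3 D4 : W) : D1 = c *: (v *m A *m jc i) -> D2 = 0 ->
    D3 = c *: (v *m jc i *m A) -> D4 = c *: (v *m Phi (kl i)) ->
    D1 + D2 - D3 - D4 = - c *: (v *m jc i.+1).
  move=> -> -> -> ->; rewrite /= !(mulmxDr, mulmxN) !mulmxA.
  move: (v *m A *m _) (v *m _ *m A) (v *m Phi _) => a1 a2 a3.
  by apply/rowP => j; rewrite !mxE; ring.
apply: fin.
- by rewrite df0 dY.
- have -> : 'D_(f0 0) Y = (fun=> 0) by rewrite f00; apply/funext => x; exact: derive0.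
  exact: derive_cst.
- by rewrite dY df0 -scalemxAl.
- by rewrite Y0 ddf0 Phi_sym -scalemxAl Phi_sym.
Qed.

Lemma lie_cst0l (Y : W -> W) : lie_bracket (fun=> 0) Y = fun=> 0.
Proof.
apply/funext => x.
have d1 : 'd Y x 0 = 0 by exact: linear0.
have d2 : 'd (fun _ : W => (0 : W)) x (Y x) = 0.
  exact: (congr1 (fun g => g (Y x)) (diff_cst (0 : W) x)).
by apply: etrans (congr2 (fun x y => x - y) d1 d2) _; rewrite subrr.
Qed.

Lemma lie_cst0r (Y : W -> W) : lie_bracket Y (fun=> 0) = fun=> 0.
Proof. by rewrite lieC lie_cst0l; apply/funext => x; rewrite oppr0. Qed.

Lemma lie_self (Y : W -> W) : lie_bracket Y Y = fun=> 0.
Proof. by apply/funext => x; rewrite /lie_bracket subrr. Qed.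

(** The counts 0, 1, 2 are treated together. Count 0 yields only [f0] and zero; count 2 arises
    either from [f0] and count 2, where stability under [A] suffices, or from two brackets of count
    1, which give a multiple of [beta]. *)
Lemma bracket_sub m (S : 'M[R]_(m, n)) : (S *m A <= S)%MS ->
  (forall i, (kl i <= S)%MS) ->
  (forall i j, (beta A H b Phi i j <= S)%MS) ->
  forall j X, iter_bracket f0 f1 j X -> [/\ j = 0%N -> X = f0 \/ X = (fun=> 0),
    j = 1%N -> jet_one X & j = 2%N -> (X 0 <= S)%MS].
Proof.
move=> AS klS betaS j X; elim => [||p q Y Z _ [Y0 Y1 Y2] _ [Z0 Z1 Z2]].
- by split=> // _; left.
- by split=> // _; exact: jet_one_f1.
have zero2 Q : (Q 0 <= S)%MS -> (lie_bracket f0 Q 0 <= S)%MS.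
  move=> QS; have d1 : 'd Q 0 (f0 0) = 0 by rewrite f00; exact: linear0.
  have d2 : 'd f0 0 (Q 0) = Q 0 *m A by rewrite diff0_derive.
  have -> : lie_bracket f0 Q 0 = - (Q 0 *m A).
    by apply: etrans (congr2 (fun x y => x - y) d1 d2) _; rewrite sub0r.
  by rewrite eqmx_opp; apply: submx_trans AS; exact: submxMr.
split.
- move=> /eqP; rewrite addn_eq0 => /andP[/eqP/Y0 Yc /eqP/Z0 Zc]; right.
  case: Yc Zc => -> [] ->;
    [exact: lie_self|exact: lie_cst0r|exact: lie_cst0l|exact: lie_cst0l].
- case: p Y0 Y1 Y2 => [|[|p]] Y0 Y1 Y2.
  + rewrite add0n => q1; have JZ := Z1 q1.
    by case: (Y0 erefl) => ->; [exact: jet_one_lie|rewrite lie_cst0l;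
      exact: jet_one_cst0].
  + case: q Z0 Z1 Z2 => [|q] Z0 Z1 Z2 //= _; have JY := Y1 erefl.
    case: (Z0 erefl) => ->; last by rewrite lie_cst0r; exact: jet_one_cst0.
    by rewrite lieC; apply: jet_oneN; exact: jet_one_lie.
  + by [].
- case: p Y0 Y1 Y2 => [|[|[|p]]] Y0 Y1 Y2.
  + rewrite add0n => q2; have ZS := Z2 q2.
    case: (Y0 erefl) => ->; first exact: zero2.
    by rewrite lie_cst0l sub0mx.
  + case: q Z0 Z1 Z2 => [|[|q]] Z0 Z1 Z2 //= _.
    have [sY [i [c [Yi dY]]]] := Y1 erefl; have [sZ [j' [c' [Zj dZ]]]] := Z1 erefl.
    have d1 : 'd Z 0 (Y 0) = (c * c') *: (kl i *m jc j').
      by rewrite diff0_derive// dZ Yi -scalemxAl scalerA mulrC.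
    have d2 : 'd Y 0 (Z 0) = (c * c') *: (kl j' *m jc i).
      by rewrite diff0_derive// dY Zj -scalemxAl scalerA.
    have -> : lie_bracket Y Z 0 = (c * c') *: beta A H b Phi i j'.
      by apply: etrans (congr2 (fun x y => x - y) d1 d2) _; rewrite -scalerBr.
    by apply: scalemx_sub; exact: betaS.
  + case: q Z0 Z1 Z2 => [|q] Z0 Z1 Z2 //= _; have YS := Y2 erefl.
    case: (Z0 erefl) => ->; last by rewrite lie_cst0r sub0mx.
    by rewrite lieC eqmx_opp; exact: zero2.
  + by [].
Qed.

Lemma kal_bracket i : exists2 X, iter_bracket f0 f1 1 X & X 0 = kl i.
Proof.
elim: i => [|i [X bX X0]]; first by exists f1 => //; exact: iter_bracket1.
(* With [f0] on the right the value is [X 0 *m A] without a sign. *)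
exists (lie_bracket X f0); first exact: (iter_bracketL bX (iter_bracket0 f0 f1)).
have d1 : 'd f0 0 (X 0) = kl i.+1 by rewrite diff0_derive// df0 X0.
have d2 : 'd X 0 (f0 0) = 0 by rewrite f00; exact: linear0.
by apply: etrans (congr2 (fun x y => x - y) d1 d2) _; rewrite subr0.
Qed.

Lemma lie_space2_sub m (S : 'M[R]_(m, n)) : (S *m A <= S)%MS ->
  (forall i, (kl i <= S)%MS) ->
  (forall i j, (beta A H b Phi i j <= S)%MS) ->
  forall v, lie_space f0 f1 2 v -> (v <= S)%MS.
Proof.
move=> AS klS betaS v; apply: lin_span_sub => w [j [X [j2 bX ->]]].
have [h0 h1 h2] := bracket_sub AS klS betaS bX.
case: j j2 bX h0 h1 h2 => [|[|[|j]]] j2 bX h0 h1 h2.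
- by case: (h0 erefl) => ->; rewrite ?f00 sub0mx.
- have [_ [i [c [-> _]]]] := h1 erefl; exact: scalemx_sub.
- exact: h2.
- by move: j2.
Qed.

Lemma sub_lie_space1 m v : (v <= kal_mx A b m)%MS -> lie_space f0 f1 1 v.
Proof.
move=> /submxP[c ->]; exists [seq kl i | i <- iota 0 m].
  move=> w /mapP[i _ ->]; have [X bX X0] := kal_bracket i.
  by exists 1%N, X; split.
rewrite mulmx_sum_row; apply: memv_suml => i _; apply: memvZ.
rewrite rowK; apply: memv_span; apply: map_f.
by rewrite mem_iota ltn_ord.
Qed.

End brackets.

(** * Restriction of the system to zero control *)

Section slices.
Context {R : realType} {n : nat} {U : normedModType R}.
Local Notation V := ('rV[R]_n * R)%type.
Implicit Types g : V -> U.

Lemma derive_slice g v x : 'D_v (fun x => g (x, 0)) x = 'D_(v, 0) g (x, 0).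
Proof.
have E : (fun h : R => h^-1 *: (g ((h *: v + x), 0) - g (x, 0))) =
    (fun h : R => h^-1 *: (g (h *: ((v, 0) : V) + (x, 0)) - g (x, 0))).
  apply/funext => h; congr (_ *: (g _ - _)).
  by congr pair; rewrite /= scaler0 addr0.
exact: (congr1 (fun F => lim (F @ 0^')) E).
Qed.

Lemma smooth_slice g : smooth g -> smooth (fun x : 'rV[R]_n => g (x, 0)).
Proof.
have dp x : differentiable (fun x : 'rV[R]_n => (x, 0) : V) x.
  by apply: differentiable_pair; [exact: ex_diff|exact: differentiable_cst].
move=> sg k; elim: k g sg => [|k IH] g sg.
  move=> x; apply: (@continuous_comp _ _ _ (fun x => (x, 0)) g).
    exact: differentiable_continuous (dp x).
  exact: smooth_continuous.
split=> [x|v].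
  apply: (@differentiable_comp _ _ _ _ (fun x => (x, 0)) g).
    exact: dp.
  exact: smooth_differentiable.
have -> : 'D_v (fun x => g (x, 0)) = (fun x => 'D_(v, 0) g (x, 0)).
  by apply/funext => x; exact: derive_slice.
exact: (IH _ (smooth_derive (v, 0) sg)).
Qed.

Lemma derive1_slice g x u : smooth g ->
  (fun u => g (x, u))^`() u = 'D_(0, 1) g (x, u).
Proof.
move=> sg.
have pE s : ((x, 0) : V) + s *: (0, 1) = (x, s).
  by congr pair; rewrite /= ?scaler0 ?addr0// add0r [_%:A]mulr1.
have E : (fun t : R => g ((x, 0) + t *: (0, 1))) = (fun u => g (x, u)).
  by apply/funext => t; rewrite pE.
have d := derive_line (smooth_differentiable sg (((x, 0) : V) + u *: (0, 1))).
have [_ dv] := d; rewrite derive1E -E; apply: etrans dv _; by rewrite pE.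
Qed.

End slices.

Theorem corollary1 (R : realType) (n : nat) (f : 'rV[R]_n * R -> 'rV[R]_n)
    (hf : smooth f) (hf0 : f (0, 0) = 0) (hc : smoothly_STLC f) :
  let f0 := fun x : 'rV[R]_n => f (x, 0) in
  let f1 := fun x : 'rV[R]_n => (fun u : R => f (x, u))^`() 0 in
  let d0 := (fun u : R => f (0, u))^`(2) 0 in
  [set s + c *: d0 | s in lie_space f0 f1 2 & c in [set: R]]
  = lie_space f0 f1 1.
Proof.
move=> f0 f1 d0.
have sf1' : smooth ('D_(0, 1) f) by exact: smooth_derive.
have f1E : f1 = fun x => 'D_(0, 1) f (x, 0).
  by apply/funext => x; exact: derive1_slice.
have d0E : d0 = vecq f.
  have E : (fun u : R => f (0, u))^`() = (fun u => 'D_(0, 1) f (0, u)).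
    by apply/funext => u; exact: derive1_slice.
  rewrite /d0 derive1nS derive1n1 E; exact: derive1_slice.
set A := linA f; set H := matH f; set b := vecb f; set Phi := bilPhi f.
have Phi_sym x y : x *m Phi y = y *m Phi x by exact: bilPhi_sym.
have sf0 : smooth_field f0.
  by move=> i; exact: (smooth_slice (smooth_coord i hf)).
have sf1 : smooth_field f1.
  by rewrite f1E => i; exact: (smooth_slice (smooth_coord i sf1')).
have df0 v : 'D_v f0 0 = v *m A.
  exact: etrans (derive_slice f v 0) (esym (linAE hf v)).
have ddf0 v w : 'D_v ('D_w f0) 0 = v *m Phi w.
  have -> : 'D_w f0 = (fun x => 'D_(w, 0) f (x, 0)).
    by apply/funext => x; exact: derive_slice.
  exact: etrans (derive_slice ('D_(w, 0) f) v 0) (esym (bilPhiE hf w v)).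
have f10 : f1 0 = b by rewrite f1E.
have df1 v : 'D_v f1 0 = v *m H.
  rewrite f1E.
  exact: etrans (derive_slice ('D_(0, 1) f) v 0) (esym (matHE hf v)).
(* The row space of [S] is $S_1$; the inclusion from left to right passes through it. *)
have [m klS] := kal_stable A b; set S := kal_mx A b m in klS.
have AS : (S *m A <= S)%MS.
  by apply: submx_trans (kal_mxA A b m) _; apply: kal_mx_sub => i _; exact: klS.
have [r r0 [C C0 HC]] := system_taylor hf hf0.
have drS : forall k, (drift A H b (vecq f) Phi k <= S)%MS.
  exact: (stlc_drift_sub Phi_sym (smooth_continuous hf) hc r0 C0 HC AS klS).
have betaS := all_beta_sub Phi_sym AS drS.
have space_sub := lie_space2_sub Phi_sym sf0 sf1 hf0 df0 ddf0 f10 df1 AS klS betaS.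
have sub_space := sub_lie_space1 sf0 hf0 df0 f10.
apply/seteqP; split=> [_ [s sS [c _ <-]]|v [e eS ve]].
  apply: (sub_space m); apply: addmx_sub; first exact: space_sub.
  (* The vector [d0] is the drift of index 0. *)
  by apply: scalemx_sub; rewrite d0E; exact: (drS 0%N).
exists v; last by exists 0; [exact: I|rewrite scale0r; exact: addr0].
exists e; last exact: ve.
move=> w /eS[j [X [j1 bX wE]]]; exists j, X; split; [exact: leqW|exact: bX|exact: wE].
Qed.
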